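(* Let $k\subset\mathbb{R}$ be a subfield. On the set $\mathbf{Pol}_k(\infty)$ the transfinite pyramidal growth $\underset{\infty}{\le}$ coincides with the inclusion order: for all $P,Q\in\mathbf{Pol}_k(\infty)$ one has $P\underset{\infty}{\le}Q$ if and only if $P\subset Q$.
   Context: Work in the real vector space $\bigoplus_{\mathbb N}\mathbb{R}$ (finitely supported real sequences) with the Euclidean norm. A polytope is the convex hull of a finite subset of this space. For a subfield $k\subset\mathbb R$, $\mathbf{Pol}_k(\infty)$ is the set of all polytopes whose vertices lie in $\bigoplus_{\mathbb N}k$. A pyramid over (with base) a polytope $P$ is $\operatorname{conv}(P\cup\{v\})$ for a point $v$ not in the affine hull of $P$. A pair $P\subset Q$ of polytopes in $\mathbf{Pol}_k(\infty)$ is a pyramidal extension if $\Delta=\overline{Q\setminus P}$ (topological closure) is a pyramid and $\Delta\cap P$ is a facet of $\Delta$ (so either $Q$ is a pyramid over $P$, or $Q$ is obtained from $P$ by stacking a pyramid onto a facet). The pyramidal growth $\underset{\Delta}{\le}$ is the partial order on $\mathbf{Pol}_k(\infty)$ generated by pyramidal extensions within $\mathbf{Pol}_k(\infty)$ (i.e. its reflexive–transitive closure). The transfinite pyramidal growth $\underset{\infty}{\le}$ is the smallest partial order on $\mathbf{Pol}_k(\infty)$ containing $\underset{\Delta}{\le}$ and such that $P\underset{\infty}{\le}Q$ whenever there is an ascending sequence $P=P_0\underset{\infty}{\le}P_1\underset{\infty}{\le}P_2\underset{\infty}{\le}\cdots$ in $\mathbf{Pol}_k(\infty)$ with $\lim_{i\to\infty}d_H(P_i,Q)=0$,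 where $d_H$ is the Hausdorff distance. *)

(* Defs.v *)
From HB Require Import structures.
From Stdlib Require Relation_Definitions Relation_Operators.
From mathcomp Require Import all_boot all_order all_algebra.
From mathcomp Require Import ring.
From mathcomp Require Import all_classical all_reals all_analysis.

Set Implicit Arguments.
Unset Strict Implicit.
Unset Printing Implicit Defensive.

Import Order.TTheory GRing.Theory Num.Theory.

Local Open Scope classical_set_scope.
Local Open Scope ring_scope.

Section FinSeqPred.
Variable R : realType.

Definition fin_supp : {pred nat -> R^o} :=
  fun x => `[< finite_set [set i | x i != 0] >].

Lemma fin_suppP (x : nat -> R^o) :
  reflect (exists n, forall i, (n <= i)%N -> x i = 0) (x \in fin_supp).
Proof.
apply: (iffP (asboolP _)) => [fx|[n xn]].
  have [n nP] : exists n, forall i, [set i | x i != 0] i -> (i < n)%N.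
    move: fx => /finite_seqP[s sE].
    exists (\max_(i <- s) i).+1 => i; rewrite sE /= ltnS => si.
    exact: leq_bigmax_seq.
  exists n => i ni; apply/eqP; apply: contraTT ni => xi.
  by rewrite -ltnNge; exact: nP.
apply: (@sub_finite_set _ _ `I_n); last exact: finite_II.
by move=> i /=; apply: contraNT; rewrite -leqNgt => /xn ->.
Qed.

Fact fin_supp_submod : submod_closed fin_supp.
Proof.
split; first by apply/fin_suppP; exists 0%N.
move=> a x y /fin_suppP[n xn] /fin_suppP[m ym].
apply/fin_suppP; exists (maxn n m) => i; rewrite geq_max => /andP[ni mi].
by rewrite [LHS](_ : _ = a * x i + y i)// xn// ym// mulr0 addr0.
Qed.

HB.instance Definition _ :=
  GRing.isSubmodClosed.Build R (nat -> R^o) fin_supp fin_supp_submod.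

End FinSeqPred.

(* The space of finitely supported sequences.  It is a fresh record, rather than
   a sigma type, so that it carries only the topology of the Euclidean norm. *)
Record finseq (R : realType) := FinSeq {
  coords :> nat -> R^o;
  coordsP : coords \in @fin_supp R
}.

HB.instance Definition _ (R : realType) := [isSub for @coords R].
HB.instance Definition _ (R : realType) := [Choice of finseq R by <:].
HB.instance Definition _ (R : realType) :=
  [SubChoice_isSubLmodule of finseq R by <:].

Section EuclideanNorm.
Variable R : realType.
Implicit Types (x y : finseq R) (a : R) (n : nat).

Definition euclid_norm x : R := Num.sqrt (\sum_(i \in [set: nat]) x i ^+ 2).

Lemma coordsD x y i : (x + y) i = x i + y i. Proof. by []. Qed.

Lemma coordsZ a x i : (a *: x) i = a * x i. Proof. by []. Qed.

Lemma finseq_bound x : exists n, forall i, (n <= i)%N -> x i = 0.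
Proof. by apply/fin_suppP; exact: coordsP. Qed.

Lemma euclid_normE x n : (forall i, (n <= i)%N -> x i = 0) ->
  euclid_norm x = Num.sqrt (\sum_(i < n) x i ^+ 2).
Proof.
move=> xn; congr Num.sqrt; rewrite (fsbig_ord _ _ (fun i => x i ^+ 2)).
apply/esym/fsbig_widen => // i [_ /=] /negP; rewrite -leqNgt => /xn ->.
by rewrite expr0n.
Qed.

Let sumsq_ge0 x n : 0 <= \sum_(i < n) x i ^+ 2.
Proof. by apply: sumr_ge0 => i _; exact: sqr_ge0. Qed.

Let sumsq_eq0 x n : \sum_(i < n) x i ^+ 2 = 0 -> forall i : 'I_n, x i = 0.
Proof.
move=> /eqP; rewrite psumr_eq0 => [/allP x0 i|i _]; last exact: sqr_ge0.
by have := x0 i (mem_index_enum _); rewrite sqrf_eq0 => /eqP.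
Qed.

Let cauchy_schwarz x y n : \sum_(i < n) x i * y i <=
  Num.sqrt (\sum_(i < n) x i ^+ 2) * Num.sqrt (\sum_(i < n) y i ^+ 2).
Proof.
set A := Num.sqrt _; set B := Num.sqrt _.
have A2 : A ^+ 2 = \sum_(i < n) x i ^+ 2 by rewrite sqr_sqrtr.
have B2 : B ^+ 2 = \sum_(i < n) y i ^+ 2 by rewrite sqr_sqrtr.
have A0 : 0 <= A by exact: sqrtr_ge0.
have B0 : 0 <= B by exact: sqrtr_ge0.
have [AB0|AB0] := eqVneq (A * B) 0.
  rewrite AB0 big1// => i _; move/eqP: AB0; rewrite mulf_eq0 => /orP[] /eqP E0.
    by rewrite (@sumsq_eq0 x n) ?mul0r// -A2 E0 expr0n.
  by rewrite (@sumsq_eq0 y n) ?mulr0// -B2 E0 expr0n.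
have ABgt0 : 0 < A * B by rewrite lt_neqAle eq_sym AB0 mulr_ge0.
have : 0 <= \sum_(i < n) (x i * B - y i * A) ^+ 2.
  by apply: sumr_ge0 => i _; exact: sqr_ge0.
have -> : \sum_(i < n) (x i * B - y i * A) ^+ 2 =
    2 * (A * B) * (A * B - \sum_(i < n) x i * y i).
  transitivity (\sum_(i < n) (x i ^+ 2 * B ^+ 2 + y i ^+ 2 * A ^+ 2
                              - 2 * (A * B) * (x i * y i))).
    by apply: eq_bigr => i _; ring.
  by rewrite sumrB big_split/= -!mulr_suml -mulr_sumr -A2 -B2; ring.
by rewrite (pmulr_rge0 _ (mulr_gt0 (ltr0n _ 2) ABgt0)) subr_ge0.
Qed.

Fact euclid_normD x y : euclid_norm (x + y) <= euclid_norm x + euclid_norm y.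
Proof.
have [n xn] := finseq_bound x; have [m ym] := finseq_bound y.
pose p := maxn n m.
have xp i : (p <= i)%N -> x i = 0 by rewrite geq_max => /andP[/xn].
have yp i : (p <= i)%N -> y i = 0 by rewrite geq_max => /andP[_ /ym].
have xyp i : (p <= i)%N -> (x + y) i = 0.
  by move=> pi; rewrite coordsD xp// yp// addr0.
rewrite (euclid_normE xp) (euclid_normE yp) (euclid_normE xyp).
rewrite -[leRHS]ger0_norm ?addr_ge0 ?sqrtr_ge0// -sqrtr_sqr.
apply: ler_wsqrtr; rewrite sqrrD !sqr_sqrtr//.
under eq_bigr do rewrite coordsD sqrrD.
rewrite big_split big_split/= sumrMnl; apply: lerD => //; apply: lerD => //.
by rewrite lerMn2r/=; exact: cauchy_schwarz.
Qed.

Fact euclid_normZ a x : euclid_norm (a *: x) = `|a| * euclid_norm x.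
Proof.
have [n xn] := finseq_bound x.
have axn i : (n <= i)%N -> (a *: x) i = 0.
  by move=> ni; rewrite coordsZ xn// mulr0.
rewrite (euclid_normE xn) (euclid_normE axn).
under eq_bigr do rewrite coordsZ exprMn.
by rewrite -mulr_sumr sqrtrM ?sqr_ge0// sqrtr_sqr.
Qed.

Fact euclid_norm_eq0 x : euclid_norm x = 0 -> x = 0.
Proof.
have [n xn] := finseq_bound x.
rewrite (euclid_normE xn) => /eqP; rewrite sqrtr_eq0 => x0.
have /sumsq_eq0 {}x0 : \sum_(i < n) x i ^+ 2 = 0.
  by apply/eqP; rewrite eq_le x0 sumsq_ge0.
apply: val_inj; apply/funext => i /=; have [ni|ni] := leqP n i.
  exact: xn.
exact: (x0 (Ordinal ni)).
Qed.

End EuclideanNorm.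

HB.instance Definition _ (R : realType) :=
  Lmodule_isNormed.Build R (finseq R)
    (@euclid_normD R) (@euclid_normZ R) (@euclid_norm_eq0 R).

Section Polytopes.
Variable R : realType.
Local Notation E := (finseq R).
Implicit Types (A P Q F : set E) (n : nat).

Definition conv_hull A : set E := smallest (@convex_set R E) A.

Definition aff_hull A : set E := [set y | exists n (c : 'I_n -> R) (x : 'I_n -> E),
  [/\ forall i, A (x i), \sum_i c i = 1 & y = \sum_i c i *: x i]].

Definition aff_indep n (x : 'I_n -> E) : Prop :=
  forall c : 'I_n -> R, \sum_i c i = 0 -> \sum_i c i *: x i = 0 ->
  forall i, c i = 0.

(* [has_dim_succ A n] means that A has dimension n - 1; the shift gives the
   empty set its usual dimension -1. *)
Definition has_dim_succ A n : Prop := exists x : 'I_n -> E,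
  aff_indep x /\ aff_hull (range x) = aff_hull A.

Definition polytope P : Prop := exists2 S : set E, finite_set S & P = conv_hull S.

(* The functional 0 yields the improper faces P and set0. *)
Definition face P F : Prop := exists (f : {scalar E}) (b : R),
  (forall x, P x -> f x <= b) /\ F = P `&` [set x | f x = b].

Definition facet P F : Prop :=
  face P F /\ exists n, has_dim_succ F n /\ has_dim_succ P n.+1.

Definition vertex P (v : E) : Prop := face P [set v].

Definition pyramid P : Prop := exists (B : set E) (v : E),
  [/\ polytope B, ~ aff_hull B v & P = conv_hull (B `|` [set v])].

Definition pyramidal_extension P Q : Prop :=
  let D := closure (Q `\` P) in [/\ P `<=` Q, pyramid D & facet D (D `&` P)].

(* The outer maximum with 0 only matters when P and Q are both empty, the
   suprema being taken in [0, +oo]. *)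
Definition hausdorff_dist P Q : \bar R :=
  maxe 0%E (maxe (ereal_sup [set edist_inf Q x | x in P])
                 (ereal_sup [set edist_inf P y | y in Q])).

End Polytopes.

(* A subset of the field R is a subfield exactly when it contains 1 and is
   closed under subtraction and division. *)
Section Growth.
Variables (R : realType) (k : divringClosed R).

Definition Pol : set (set (finseq R)) := [set P |
  polytope P /\ forall v, vertex P v -> forall i, v i \in k].

Definition pyramidal_growth : Pol -> Pol -> Prop :=
  Relation_Operators.clos_refl_trans Pol
    (fun P Q => pyramidal_extension (val P) (val Q)).

Definition limit_closed (r : Pol -> Pol -> Prop) : Prop :=
  forall (P : nat -> Pol) (Q : Pol),
    (forall i, r (P i) (P i.+1)) ->
    hausdorff_dist (val (P i)) (val Q) @[i --> \oo] --> 0%E ->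
    r (P 0%N) Q.

(* The intersection of all the partial orders with the two required properties.
   Inclusion is one of them, which makes the intersection antisymmetric, hence
   the smallest such partial order. *)
Definition transfinite_growth (P Q : Pol) : Prop :=
  forall r : Pol -> Pol -> Prop,
    Relation_Definitions.order Pol r ->
    (forall P' Q', pyramidal_growth P' Q' -> r P' Q') ->
    limit_closed r ->
    r P Q.

End Growth.

(* Main.v *)
From HB Require Import structures.
From Stdlib Require Relation_Definitions Relation_Operators.
Require Import Defs.
From mathcomp Require Import all_boot all_order all_algebra.
From mathcomp Require Import ring lra.
From mathcomp Require Import all_classical all_reals all_analysis.

(* Polytopes are replaced by the cones over them: a polytope is the slice x_0 = 1
   of a pointed cone in R^(n+1), and the empty polytope is the slice of the cone
   {0}.  By induction on the dimension, every reflexive and transitive relation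
   that contains the stackings and is closed under limits contains the inclusion
   of pointed rational cones.

   Dropping the inequalities of P one at a time, it is enough to grow the facet
   F of points of Q with h = 0 to the part D of Q with h <= 0.  Let b be an
   extreme ray of F.  In the quotient by b, which has smaller dimension, the
   projection of F grows to that of D by stackings and limits.  Limits lift to
   fibres.  A stacking with apex w lifts to the stacking whose apex b' is the
   point where the fibre of w leaves D, followed by an inclusion that is again
   radial, now from b'.  The radial inclusion from b' involves fewer facets of D
   than the one from b, so that a second induction, on the number of these
   facets, concludes. *)

Set Implicit Arguments.
Unset Strict Implicit.
Unset Printing Implicit Defensive.

Import Order.TTheory GRing.Theory Num.Theory.
Import numFieldNormedType.Exports.

Local Open Scope classical_set_scope.
Local Open Scope ring_scope.

(** * Finitely generated cones *)

Section Dot.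
Variable R : comNzRingType.

(** No chain of extensions is ever constructed or indexed. The inductive statement quantifies over
    all relations closed under the permitted steps, so growth is transported by defining, from the
    given relation, a new one on a smaller object and checking the same closure properties. Every
    such relation is an inclusion together with an implication guarded by bounds on its two ends;
    the inclusion is what hands these bounds on to intermediate cones.

    The obstacle is that the part of D over a new pyramid of the quotient is usually larger than a
    pyramid. Coning from b' fills a part of it, and the rest is seen from b' only through facets
    that miss b'. As b' lies on a facet that obstructed b, that facet disappears from the list. All
    apexes stay over [k]: an exit point is obtained by dividing values of rational functionals at
    rational vectors.

    The converse direction is short: inclusion is itself an admissible order, because polytopes are
    closed. *)

Definition dot n (a x : 'rV[R]_n) : R := (a *m x^T) 0 0.

Variable n : nat.
Implicit Types a b x y : 'rV[R]_n.

Lemma dotE a x : dot a x = \sum_i a 0 i * x 0 i.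
Proof. by rewrite /dot mxE; apply: eq_bigr => i _; rewrite mxE. Qed.

Lemma dotC a x : dot a x = dot x a.
Proof. by rewrite !dotE; apply: eq_bigr => i _; rewrite mulrC. Qed.

Lemma dotDr a x y : dot a (x + y) = dot a x + dot a y.
Proof. by rewrite /dot linearD mulmxDr mxE. Qed.

Lemma dotZr a c x : dot a (c *: x) = c * dot a x.
Proof. by rewrite /dot linearZ -scalemxAr mxE. Qed.

Lemma dotNr a x : dot a (- x) = - dot a x.
Proof. by rewrite -scaleN1r dotZr mulN1r. Qed.

Lemma dotBr a x y : dot a (x - y) = dot a x - dot a y.
Proof. by rewrite dotDr dotNr. Qed.

Lemma dot0r a : dot a 0 = 0.
Proof. by rewrite -(scale0r 0) dotZr mul0r. Qed.

Lemma dotDl a b x : dot (a + b) x = dot a x + dot b x.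
Proof. by rewrite dotC dotDr !(dotC x). Qed.

Lemma dotZl c a x : dot (c *: a) x = c * dot a x.
Proof. by rewrite dotC dotZr (dotC x). Qed.

Lemma dotNl a x : dot (- a) x = - dot a x.
Proof. by rewrite dotC dotNr dotC. Qed.

Lemma dotBl a b x : dot (a - b) x = dot a x - dot b x.
Proof. by rewrite dotDl dotNl. Qed.

Lemma dot_mulmx m (a : 'rV[R]_m) x (M : 'M[R]_(n, m)) :
  dot a (x *m M) = dot (a *m M^T) x.
Proof. by rewrite /dot trmx_mul mulmxA. Qed.

Lemma dot_delta (i : 'I_n) x : dot (delta_mx 0 i) x = x 0 i.
Proof.
rewrite dotE (bigD1 i)//= mxE !eqxx mul1r big1 ?addr0// => j ji.
by rewrite mxE (negbTE ji) andbF mul0r.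
Qed.

End Dot.

Definition dotr := (dotDr, dotBr, dotZr, dotNr, dot0r).

Section FiniteBounds.
Variables (R : realFieldType) (T : eqType).
Implicit Types (s : seq T) (f : T -> R).

(** Bounding among nonnegative numbers gives the empty sequence the bound 0. This supplies the
    parameter in the elimination below and the constants of later estimates. *)
Lemma seq_lub0 s f : exists t, [/\ 0 <= t, {in s, forall b, f b <= t} &
  forall u, 0 <= u -> {in s, forall b, f b <= u} -> t <= u].
Proof.
elim: s => [|b s [t [t0 st tP]]]; first by exists 0; split.
exists (Num.max (f b) t); split.
- by rewrite le_max t0 orbT.
- move=> c; rewrite in_cons => /orP[/eqP ->|cs]; rewrite le_max ?lexx//.
  by rewrite st// orbT.
- move=> u u0 su; rewrite ge_max su ?mem_head//= tP// => c cs.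
  by rewrite su// in_cons cs orbT.
Qed.

Lemma seq_argmax s f : s != [::] -> exists2 a, a \in s &
  {in s, forall b, f b <= f a}.
Proof.
elim: s => // b [_ _|c s IH _].
  by exists b; rewrite ?mem_head// => c; rewrite inE => /eqP ->.
have [//|a acs aP] := IH; have [fba|fab] := leP (f b) (f a).
  exists a; first by rewrite in_cons acs orbT.
  by move=> d; rewrite in_cons => /orP[/eqP ->//|/aP].
exists b; first exact: mem_head.
move=> d; rewrite in_cons => /orP[/eqP ->//|/aP fda].
exact: le_trans fda (ltW fab).
Qed.

End FiniteBounds.

Section Cones.
Variable R : realFieldType.

Section OneSpace.
Variable n : nat.
Local Notation V := 'rV[R]_n.
Implicit Types (a b v w x y : V) (s L : seq V) (C X Y Z G : set V).

(** The Minkowski sum of [G] and the ray of [w]; on slices, the join of a polytope with a point. *)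
Definition adjoin G w : set V := [set x | exists2 t, 0 <= t & G (x - t *: w)].

Fixpoint cone s : set V :=
  if s is v :: s' then adjoin (cone s') v else [set 0].

Definition halfspaces L : set V := [set x | {in L, forall a, 0 <= dot a x}].

Definition convex_cone C := [/\ C 0, forall x y, C x -> C y -> C (x + y) &
  forall c x, 0 <= c -> C x -> C (c *: x)].

Definition pointed C := exists g, forall x, C x -> x != 0 -> 0 < dot g x.

Lemma cone_convex s : convex_cone (cone s).
Proof.
elim: s => [|v s [s0 sD sZ]]; split => //=.
- by move=> x y -> ->; rewrite addr0.
- by move=> c x _ ->; rewrite scaler0.
- by exists 0; rewrite ?scale0r ?subr0.
- move=> x y [t t0 xt] [u u0 yu]; exists (t + u); first exact: addr_ge0.
  by rewrite scalerDl opprD addrACA; exact: sD.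
- move=> c x c0 [t t0 xt]; exists (c * t); first exact: mulr_ge0.
  by rewrite -scalerA -scalerBr; exact: sZ.
Qed.

Lemma mem_adjoin G w x : G x -> adjoin G w x.
Proof. by move=> Gx; exists 0; rewrite // scale0r subr0. Qed.

Lemma adjoin_apex G w : G 0 -> adjoin G w w.
Proof. by move=> G0; exists 1; rewrite // scale1r subrr. Qed.

Lemma adjoin_min G w C : convex_cone C -> G `<=` C -> C w -> adjoin G w `<=` C.
Proof.
move=> [_ CD CZ] GC Cw x [t t0 /GC Cx]; rewrite -(subrK (t *: w) x).
by apply: CD => //; exact: CZ.
Qed.

Lemma cone_mem s v : v \in s -> cone s v.
Proof.
elim: s => // w s IH; rewrite in_cons => /orP[/eqP ->|/IH sv] /=.
  by apply: adjoin_apex; case: (cone_convex s).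
exact: mem_adjoin.
Qed.

Lemma cone_min s C : convex_cone C -> {in s, forall v, C v} -> cone s `<=` C.
Proof.
move=> CC; elim: s => [_ x ->|v s IH sC]; first by case: CC.
apply: adjoin_min => //; last by apply: sC; rewrite mem_head.
by apply: IH => w ws; apply: sC; rewrite in_cons ws orbT.
Qed.

Lemma halfspaces_convex L : convex_cone (halfspaces L).
Proof.
split=> [a _|x y Lx Ly a aL|c x c0 Lx a aL]; rewrite dotr//.
- by rewrite addr_ge0// (Lx, Ly).
- by rewrite mulr_ge0// Lx.
Qed.

Lemma cone_cat s s' x :
  cone (s ++ s') x <-> exists y z, [/\ cone s y, cone s' z & x = y + z].
Proof.
elim: s x => [|v s IH] x /=; split.
- by move=> xs; exists 0, x; rewrite add0r.
- by move=> [_ [z [-> xs ->]]]; rewrite add0r.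
- move=> [t t0 /IH[y [z [ys zs xyz]]]]; exists (t *: v + y), z; split => //.
    by exists t => //; rewrite addrC addKr.
  by rewrite -addrA -xyz addrC subrK.
- move=> [y [z [[t t0 yt] zs ->]]]; exists t => //; apply/IH.
  by exists (y - t *: v), z; split => //; rewrite addrAC.
Qed.

Lemma pointedW C C' : C `<=` C' -> pointed C' -> pointed C.
Proof. by move=> CC' [g gP]; exists g => x /CC'; exact: gP. Qed.

Lemma pointed_opp C x : pointed C -> C x -> C (- x) -> x = 0.
Proof.
move=> [g gP] Cx CNx; apply/eqP/negPn/negP => x0.
have := gP _ Cx x0; have := gP _ CNx; rewrite oppr_eq0 x0 dotr => /(_ isT).
lra.
Qed.

End OneSpace.

Lemma cone_map n m (M : 'M[R]_(n, m)) s :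
  cone [seq x *m M | x <- s] = [set y | exists2 x, cone s x & y = x *m M].
Proof.
apply/seteqP; split.
  apply: cone_min => [|_ /mapP[v vs ->]]; last by exists v => //; exact: cone_mem.
  case: (cone_convex s) => s0 sD sZ; split.
  - by exists 0; rewrite ?mul0mx.
  - move=> _ _ [x xs ->] [y ys ->]; exists (x + y); first exact: sD.
    by rewrite mulmxDl.
  - move=> c _ c0 [x xs ->]; exists (c *: x); first exact: sZ.
    by rewrite scalemxAl.
elim: s => [|v s IH] _ [x /= xs ->]; first by rewrite xs mul0mx.
case: xs => t t0 xt; exists t => //; apply: IH; exists (x - t *: v) => //.
by rewrite mulmxBl scalemxAl.
Qed.

Section Rational.
Variable k : divringClosed R.

Definition rat n (x : 'rV[R]_n) : bool := x \is a mxOver k.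

(** * Duality between rational generators and rational inequalities *)

Section FourierMotzkin.
Variable n : nat.
Local Notation V := 'rV[R]_n.
Implicit Types (a b v w x y : V) (s L : seq V) (X : set V).

Lemma ratD x y : rat x -> rat y -> rat (x + y).
Proof. exact: rpredD. Qed.

Lemma ratN x : rat (- x) = rat x.
Proof. exact: rpredN. Qed.

Lemma ratZ c x : c \in k -> rat x -> rat (c *: x).
Proof. exact: mxOverZ. Qed.

Lemma dot_rat a x : rat a -> rat x -> dot a x \in k.
Proof.
move=> /mxOverP ak /mxOverP xk; rewrite dotE; apply: rpred_sum => i _.
exact: rpredM.
Qed.

(* Fourier-Motzkin: the parameter t of x - t v is eliminated from the
   inequalities that describe cone s. *)
Lemma cone_halfspaces s :
  exists L, (all (@rat n) s -> all (@rat n) L) /\ cone s = halfspaces L.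
Proof.
elim: s => [|v s [L [ratL sL]]].
  exists ([seq delta_mx 0 i | i <- enum 'I_n] ++
          [seq - delta_mx 0 i | i <- enum 'I_n]); split.
    move=> _; have dk i : @rat n (delta_mx 0 i).
      by apply/mxOverP => j l; rewrite mxE; case: (_ && _); rewrite ?rpred0 ?rpred1.
    by rewrite all_cat; apply/andP; split; apply/allP => _ /mapP[i _ ->];
      rewrite ?ratN.
  apply/seteqP; split=> [_ -> a _|x xL]; first by rewrite dotr.
  apply/rowP => i; rewrite mxE; apply/eqP; rewrite eq_le; apply/andP; split.
    rewrite -oppr_ge0 -dot_delta -dotNl xL// mem_cat; apply/orP; right.
    by apply/mapP; exists i; rewrite ?mem_enum.
  rewrite -dot_delta xL// mem_cat; apply/orP; left.
  by apply/mapP; exists i; rewrite ?mem_enum.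
(* [L1] keeps the inequalities that are nonnegative at [v]; each member of [L2] combines two of
   opposite signs so that it vanishes at [v]. *)
pose L1 := [seq a <- L | 0 <= dot a v].
pose L2 := [seq dot a v *: b - dot b v *: a | a <- [seq a <- L | 0 < dot a v],
                                             b <- [seq b <- L | dot b v < 0]].
exists (L1 ++ L2); split.
  move=> /= /andP[vk /ratL /allP Lk]; rewrite all_cat; apply/andP; split.
    by apply/allP => a; rewrite mem_filter => /andP[_ /Lk].
  apply/allP => _ /allpairsP[[a b] /= [+ + ->]].
  rewrite !mem_filter => /andP[_ /Lk ak] /andP[_ /Lk bk].
  by rewrite ratD ?ratN ?ratZ// dot_rat.
apply/seteqP; split=> x.
  move=> [t t0 xt] a; have {xt} xL : halfspaces L (x - t *: v) by rewrite -sL.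
  rewrite mem_cat => /orP[].
    rewrite mem_filter => /andP[av aL]; have := xL a aL; rewrite !dotr.
    by rewrite subr_ge0; apply: le_trans; exact: mulr_ge0.
  move=> /allpairsP[[b c] /= [+ + ->]].
  rewrite !mem_filter => /andP[bv bL] /andP[cv cL].
  have := xL b bL; have := xL c cL; rewrite !dotr dotBl !dotZl; nra.
move=> xL.
(* Inequalities negative at [v] bound [t] from below, positive ones from above. The least admissible
   [t] is chosen, and [L2] says that it respects the upper bounds. *)
have [t [t0 tge tlub]] :=
  seq_lub0 [seq b <- L | dot b v < 0] (fun b => dot b x / dot b v).
exists t => //; suff : halfspaces L (x - t *: v) by rewrite -sL.
move=> a aL; rewrite !dotr subr_ge0.
have [av|av|av] := ltgtP (dot a v) 0.
- have := tge a; rewrite mem_filter av aL => /(_ isT).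
  by rewrite ler_ndivrMr.
- rewrite -ler_pdivlMr//; apply: tlub.
    by rewrite divr_ge0 ?(ltW av)// xL// mem_cat mem_filter aL (ltW av).
  move=> b; rewrite mem_filter => /andP[bv bL].
  rewrite ler_ndivrMr// mulrAC ler_pdivrMr//.
  have : dot a v *: b - dot b v *: a \in L1 ++ L2.
    rewrite mem_cat; apply/orP; right; apply/allpairsP; exists (a, b).
    by rewrite !mem_filter av bv aL bL.
  by move=> /xL; rewrite dotBl !dotZl => ?; lra.
- by rewrite av mulr0 xL// mem_cat mem_filter aL av lexx.
Qed.

(** Biduality: the inequalities [s] of [cone L] generate [halfspaces L]. If [L'] describes [cone s],
    each member of [L'] is nonnegative on [s], hence lies in [cone L], hence is nonnegative wherever
    [L] is. *)
Lemma halfspaces_cone L :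
  exists s, (all (@rat n) L -> all (@rat n) s) /\ halfspaces L = cone s.
Proof.
have [s [ratS LE]] := cone_halfspaces L.
have [L' [_ sE]] := cone_halfspaces s.
exists s; split => //; apply/seteqP; split=> x.
  move=> xL; rewrite sE => a aL'; rewrite dotC.
  have : cone L a.
    rewrite LE => m ms; rewrite dotC.
    by have := cone_mem ms; rewrite sE => /(_ a aL').
  have Lx : cone L `<=` halfspaces [:: x].
    apply: cone_min => [|b /xL bx _ /[!inE] /eqP ->].
      exact: halfspaces_convex.
    by rewrite dotC.
  by move=> /Lx; apply; rewrite inE.
apply: cone_min => [|m ms a aL]; first exact: halfspaces_convex.
by have := cone_mem aL; rewrite LE => /(_ m ms); rewrite dotC.
Qed.

End FourierMotzkin.
End Rational.
End Cones.

(** * Growth relations, gluing and extreme rays of rational cones *)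

Section ConeGrowth.
Variables (R : realFieldType) (k : divringClosed R).
Local Notation rat := (@rat R k _).

Definition rat_cone n (X : set 'rV[R]_n) : Prop :=
  pointed X /\ exists2 s, all rat s & X = cone s.

(** A common wall, without reference to hyperplanes: it forces the intersection of [X] and [Z] into
    [G], and for convex cones containing [G] it makes their union convex. *)
Definition links n (X Z G : set 'rV[R]_n) : Prop :=
  forall p z, X p -> Z z ->
  exists t, [/\ 0 <= t, t <= 1 & G ((1 - t) *: p + t *: z)].

(* The condition that the segments from X to w meet G says that w lies beyond no
   facet of X but G; it also covers the pyramids over X = G. *)
Definition stacking n (X X' : set 'rV[R]_n) : Prop :=
  exists G w f, [/\ rat_cone G, rat w & G `<=` X] /\
  [/\ forall x, G x -> dot f x = 0, 0 < dot f w, links X [set w] G &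
      X' = X `|` adjoin G w].

Definition close n (e : R) (x y : 'rV[R]_n) : Prop :=
  forall i, `|x 0 i - y 0 i| <= e.

(** [growth_lim] asks only for pointwise approximation by an ascending sequence; as [Q] has finitely
    many generators, this will become Hausdorff convergence of slices. *)
Record growth n (r : set 'rV[R]_n -> set 'rV[R]_n -> Prop) : Prop := Growth {
  growth_refl : forall X, rat_cone X -> r X X;
  growth_trans : forall X Y Z, rat_cone X -> rat_cone Y -> rat_cone Z ->
    r X Y -> r Y Z -> r X Z;
  growth_stacking : forall X Y, rat_cone X -> rat_cone Y ->
    stacking X Y -> r X Y;
  growth_lim : forall (X : nat -> set 'rV[R]_n) Q,
    (forall i, rat_cone (X i)) -> rat_cone Q ->
    (forall i, X i `<=` X i.+1) -> (forall i, X i `<=` Q) ->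
    (forall i, r (X i) (X i.+1)) ->
    (forall x e, Q x -> 0 < e -> exists i y, X i y /\ close e x y) ->
    r (X 0%N) Q }.

Section OneSpace.
Variable n : nat.
Implicit Types (b w x y : 'rV[R]_n) (s L : seq 'rV[R]_n).
Implicit Types (A G Q X Y Z : set 'rV[R]_n).

Lemma rat_cone_convex X : rat_cone X -> convex_cone X.
Proof. by move=> [_ [s _ ->]]; exact: cone_convex. Qed.

Lemma rat_cone_halfspaces X : rat_cone X -> exists2 L, all rat L & X = halfspaces L.
Proof.
move=> [_ [s sk ->]]; have [L [Lk ->]] := cone_halfspaces k s.
by exists L; first exact: Lk.
Qed.

Lemma halfspaces_rat_cone L : all rat L -> pointed (halfspaces L) ->
  rat_cone (halfspaces L).
Proof.
move=> Lk Lp; split=> //; have [s [sk ->]] := halfspaces_cone k L.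
by exists s; first exact: sk.
Qed.

Lemma rat_cone_adjoin G w : rat_cone G -> rat w -> pointed (adjoin G w) ->
  rat_cone (adjoin G w).
Proof.
by move=> [_ [s sk ->]] wk wp; split=> //; exists (w :: s) => //=; rewrite wk.
Qed.

Lemma rat_coneI L X : all rat L -> rat_cone X -> rat_cone (X `&` halfspaces L).
Proof.
move=> Lk Xk; have [L' L'k XE] := rat_cone_halfspaces Xk.
have XLE : X `&` halfspaces L = halfspaces (L ++ L').
  rewrite XE; apply/seteqP; split=> [x [xL' xL] a|x xL].
    by rewrite mem_cat => /orP[/xL|/xL'].
  by split=> a aL; apply: xL; rewrite mem_cat aL ?orbT.
rewrite XLE; apply: halfspaces_rat_cone; first by rewrite all_cat Lk.
by rewrite -XLE; apply: pointedW Xk.1 => x [].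
Qed.

Lemma links_mem X Z G x : links X Z G -> X x -> Z x -> G x.
Proof.
move=> XZG Xx Zx; have [t [_ _]] := XZG x x Xx Zx.
by rewrite -scalerDl subrK scale1r.
Qed.

Lemma convex_cone_segment X x y t : convex_cone X -> X x -> X y ->
  0 <= t -> t <= 1 -> X ((1 - t) *: x + t *: y).
Proof.
by move=> [_ XD XZ] Xx Xy t0 t1; apply: XD; apply: XZ; rewrite ?subr_ge0.
Qed.

(** Up to the factor 2, [p + a] is the midpoint of the segment from [p] to [a], which meets [G] at
    parameter [t]. The midpoint falls between [G] and [a] when [t <= 1 / 2], and between [p] and [G]
    otherwise. *)
Lemma links_add X A G p a : convex_cone X -> convex_cone A -> links X A G ->
  G `<=` X -> G `<=` A -> X p -> A a -> (X `|` A) (p + a).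
Proof.
move=> [_ XD XZ] [_ AD AZ] XAG GX GA Xp Aa; have [t [t0 t1 Gg]] := XAG p a Xp Aa.
have [t2|t2] := leP t (1 / 2); [right|left].
  have -> : p + a = (1 - t)^-1 *: ((1 - t) *: p + t *: a) +
                    ((1 - 2 * t) / (1 - t)) *: a.
    by apply/rowP => i; rewrite !mxE; field; lra.
  apply: AD; first by apply: AZ; [rewrite invr_ge0; lra|exact: GA].
  by apply: AZ => //; rewrite divr_ge0; lra.
have -> : p + a = t^-1 *: ((1 - t) *: p + t *: a) + ((2 * t - 1) / t) *: p.
  by apply/rowP => i; rewrite !mxE; field; lra.
apply: XD; first by apply: XZ; [rewrite invr_ge0; lra|exact: GX].
by apply: XZ => //; rewrite divr_ge0; lra.
Qed.

Lemma rat_coneU X A G : rat_cone X -> rat_cone A -> links X A G ->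
  G `<=` X -> G `<=` A -> pointed (X `|` A) -> rat_cone (X `|` A).
Proof.
move=> Xk Ak XAG GX GA XAp; split=> //.
have Xc := rat_cone_convex Xk; have Ac := rat_cone_convex Ak.
case: Xk => _ [s sk Xs]; case: Ak => _ [s' s'k As].
exists (s ++ s'); first by rewrite all_cat sk.
apply/seteqP; split=> x; rewrite cone_cat -Xs -As.
  case=> [Xx|Ax]; first by exists x, 0; rewrite addr0; split=> //; case: Ac.
  by exists 0, x; rewrite add0r; split=> //; case: Xc.
by move=> [p [a [Xp Aa ->]]]; exact: (links_add Xc Ac XAG).
Qed.

Lemma links_trans X A W G H : links X W G -> G `<=` A -> links A W H ->
  links (X `|` A) W H.
Proof.
move=> XWG GA AWH p z [Xp|Ap] Wz; last exact: AWH.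
have [t [t0 t1 /GA Ag]] := XWG p z Xp Wz.
have [u [u0 u1 Hh]] := AWH _ z Ag Wz.
exists (t + u - t * u); split; [nra|nra|].
suff -> : (1 - (t + u - t * u)) *: p + (t + u - t * u) *: z =
  (1 - u) *: ((1 - t) *: p + t *: z) + u *: z by [].
by apply/rowP => i; rewrite !mxE; ring.
Qed.

(* Two cevians of the triangle p, w, g meet. *)
Lemma links_adjoin X G w : convex_cone G -> links X [set w] G ->
  links X (adjoin G w) G.
Proof.
move=> [G0 GD GZ] XwG p z Xp [t t0 Gg].
have [s [s0 s1 Gh]] := XwG p w Xp erefl.
have [s00|sN0] := eqVneq s 0.
  have [t00|tN0] := eqVneq t 0.
    exists 1; split=> //; rewrite subrr scale0r add0r scale1r.
    by rewrite t00 scale0r subr0 in Gg.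
  exists 0; split=> //; move: Gh.
  by rewrite s00 subr0 !scale0r !addr0.
have N0 : 0 < (1 - s) * t + s by nra.
(* Weighting the point of [G] on the segment from [p] to [w] by [t], and [z - t *: w] by [s],
   cancels [w] and leaves [((1 - s) * t) *: p + s *: z]; the parameter is read off after division by
   the total weight. *)
exists (s / ((1 - s) * t + s)); split.
- by rewrite divr_ge0// ltW.
- by rewrite ler_pdivrMr// mul1r lerDr; nra.
have -> : (1 - s / ((1 - s) * t + s)) *: p + (s / ((1 - s) * t + s)) *: z =
    ((1 - s) * t + s)^-1 *: (t *: ((1 - s) *: p + s *: w) + s *: (z - t *: w)).
  by apply/rowP => i; rewrite !mxE; field; rewrite gt_eqF.
by apply: (GZ); [rewrite invr_ge0 ltW|apply: GD; apply: (GZ)].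
Qed.

Lemma stacking_sub X Y : stacking X Y -> X `<=` Y.
Proof. by move=> [G [w [f [_ [_ _ _ ->]]]]] x Xx; left. Qed.

(** A stacking on [A] with apex in [Z] is also a stacking on the union of [X] and [A]: a segment
    from [X] to the apex meets [G], which lies in [A], and continues inside the situation already
    known for [A]. *)
Lemma growth_glue (r : set 'rV[R]_n -> set 'rV[R]_n -> Prop) X Z G :
  growth r -> rat_cone X -> links X Z G -> G `<=` X -> pointed (X `|` Z) ->
  growth (fun A B => A `<=` B /\
    (G `<=` A -> B `<=` Z -> r (X `|` A) (X `|` B))).
Proof.
move=> [rR rT rS rL] Xk XZG GX XZp.
have Uk A : rat_cone A -> G `<=` A -> A `<=` Z -> rat_cone (X `|` A).
  move=> Ak GA AZ; apply: (@rat_coneU X A G) => //.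
    by move=> p z Xp /AZ; exact: XZG.
  by apply: pointedW XZp; exact: setUS.
split.
- by move=> A Ak; split=> // GA AZ; apply: rR; exact: Uk.
- move=> A B C Ak Bk Ck [AB ABr] [BC BCr]; split; first exact: subset_trans BC.
  move=> GA CZ; have GB := subset_trans GA AB; have BZ := subset_trans BC CZ.
  have AZ := subset_trans AB BZ; have GC := subset_trans GB BC.
  apply: (rT _ (X `|` B)); [exact: Uk..|exact: ABr|exact: BCr].
- move=> A B Ak Bk AB; have sAB := stacking_sub AB; split=> // GA BZ.
  apply: rS; [by apply: Uk => //; exact: subset_trans BZ|
              by apply: Uk => //; exact: subset_trans sAB|].
  case: AB => H [w [f [[Hk wk HA] [f0 fw AwH BE]]]].
  exists H, w, f; split; split=> //.
  + by apply: subset_trans HA _ => x; right.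
  + apply: links_trans GA AwH => p z Xp -> ; apply: XZG => //; apply: BZ.
    by rewrite BE; right; apply: adjoin_apex; case: (rat_cone_convex Hk).
  + by rewrite BE setUA.
- move=> A Q Ak Qk Ainc AQ Ar Alim; split=> [|GA QZ]; first exact: AQ.
  have GAi i : G `<=` A i.
    by elim: i => // i; move=> /subset_trans; apply; exact: Ainc.
  apply: (rL (fun i => X `|` A i)).
  + by move=> i; apply: Uk => //; exact: subset_trans QZ.
  + by apply: Uk => //; exact: subset_trans (AQ 0%N).
  + by move=> i; exact: setUS.
  + by move=> i; exact: setUS.
  + by move=> i; apply: (Ar i).2 => //; exact: subset_trans QZ.
  + move=> x e [Xx|Qx] e0.
      by exists 0%N, x; split; [left|move=> i; rewrite subrr normr0 ltW].
    by have [i [y [Ay xy]]] := Alim x e Qx e0; exists i, y; split=> //; right.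
Qed.

(** Some [a] separates [b] from the cone of the other generators. Tilting the positive functional
    [g] by the multiple of [a] that makes it vanish at [b] keeps it positive on the others. *)
Lemma irredundant_extreme s s' b : pointed (cone (s ++ b :: s')) -> b != 0 ->
  ~ cone (s ++ s') b ->
  exists e, [/\ dot e b = 0, {in s ++ s', forall v, v != 0 -> 0 < dot e v} &
   forall x, cone (s ++ b :: s') x ->
     0 <= dot e x /\ (dot e x = 0 -> exists2 t, 0 <= t & x = t *: b)].
Proof.
move=> [g gP] b0 bs.
have [L [_ LE]] := cone_halfspaces k (s ++ s').
have [a aL ab] : exists2 a, a \in L & dot a b < 0.
  apply: contrapT => aL; apply: bs; rewrite LE => a /= aa.
  by rewrite leNgt; apply/negP => ab; apply: aL; exists a.
have gb : 0 < dot g b.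
  by apply: gP => //; apply: cone_mem; rewrite mem_cat mem_head orbT.
have sub x : cone (s ++ s') x -> cone (s ++ b :: s') x.
  apply: cone_min => [|v vs]; first exact: cone_convex.
  by apply: cone_mem; move: vs; rewrite !mem_cat in_cons => /orP[]->;
    rewrite ?orbT.
pose c := - (dot g b / dot a b).
have c0 : 0 < c by rewrite oppr_gt0 pmulr_rlt0// invr_lt0.
have eP y : cone (s ++ s') y -> y != 0 -> 0 < dot (g + c *: a) y.
  move=> ys y0; rewrite dotDl dotZl ltr_wpDr//; last exact/gP/y0/sub.
  by apply: mulr_ge0; [exact: ltW|move: ys; rewrite LE; apply].
have eb : dot (g + c *: a) b = 0.
  by rewrite dotDl dotZl /c mulNr divfK ?subrr// lt_eqF.
exists (g + c *: a); split=> //.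
  by move=> v vs; apply: eP; exact: cone_mem.
move=> x /cone_cat[y [z [ys [t t0 zt] ->]]].
have yzs : cone (s ++ s') (y + (z - t *: b)).
  by rewrite cone_cat; exists y, (z - t *: b).
have exE : dot (g + c *: a) (y + z) = dot (g + c *: a) (y + (z - t *: b)).
  by rewrite addrA [RHS]dotBr dotZr eb mulr0 subr0.
have [y0|y0] := eqVneq (y + (z - t *: b)) 0.
  rewrite exE y0 dot0r; split=> // _; exists t => //.
  by apply/eqP; rewrite -subr_eq0 -addrA y0.
by split; rewrite exE; [exact/ltW/eP|move=> E; have := eP _ yzs y0; rewrite E ltxx].
Qed.

Lemma cone_redundant s s' b : cone (s ++ s') b ->
  cone (s ++ b :: s') = cone (s ++ s').
Proof.
move=> bs; apply/seteqP; split; apply: cone_min; try exact: cone_convex.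
  move=> v; rewrite mem_cat in_cons => /or3P[vs|/eqP -> //|vs];
  by apply: cone_mem; rewrite mem_cat vs ?orbT.
move=> v; rewrite mem_cat => vs; apply: cone_mem.
by rewrite mem_cat in_cons; case/orP: vs => ->; rewrite ?orbT.
Qed.

Lemma irredundant_system s : exists s', [/\ {subset s' <= s}, cone s' = cone s &
  forall s1 b s2, s' = s1 ++ b :: s2 -> b != 0 /\ ~ cone (s1 ++ s2) b].
Proof.
have [m] := ubnP (size s); elim: m s => // m IH s sm.
have [[s1 [b [s2 [sE bs]]]]|irr] :=
    pselect (exists s1 b s2, s = s1 ++ b :: s2 /\ cone (s1 ++ s2) b).
  have [|s' [s's s'E s'irr]] := IH (s1 ++ s2).
    by move: sm; rewrite sE !size_cat/= addnS.
  exists s'; split=> //; last by rewrite s'E sE cone_redundant.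
  move=> v /s's; rewrite sE !mem_cat in_cons => /orP[]->; by rewrite ?orbT.
exists s; split=> // s1 b s2 sE; split; last by move=> bs; apply: irr; exists s1, b, s2.
apply/eqP => b0; apply: irr; exists s1, b, s2; split=> //; rewrite b0.
by case: (cone_convex (s1 ++ s2)).
Qed.

Lemma extreme_ray X : rat_cone X -> X <> [set 0] ->
  exists b e, [/\ rat b, X b, b != 0, dot e b = 0 & forall x, X x ->
     0 <= dot e x /\ (dot e x = 0 -> exists2 t, 0 <= t & x = t *: b)].
Proof.
move=> [Xp [s0 s0k Xs0]] X0; have [s [ss0 sE irr]] := irredundant_system s0.
have Xs : X = cone s by rewrite sE.
case: s => [|b s] in ss0 sE irr Xs *; first by rewrite Xs in X0.
have [b0 bs] := irr [::] b s erefl.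
rewrite Xs in Xp; have [e [eb _ eP]] := @irredundant_extreme [::] s b Xp b0 bs.
exists b, e; rewrite Xs; split=> //.
  by move/allP : s0k; apply; apply: ss0; rewrite mem_head.
by apply: cone_mem; rewrite mem_head.
Qed.

End OneSpace.
End ConeGrowth.

(** * Inclusion of rational cones *)

Section ConeInclusion.
Variables (R : realFieldType) (k : divringClosed R).
Local Notation rat := (@rat R k _).
Local Notation rat_cone := (rat_cone k).
Local Notation stacking := (stacking k).
Local Notation growth := (growth k).

(** At a coordinate [i] where [b] does not vanish, [M] subtracts the multiple of [b] that clears [i]
    and then drops [i]; [N] puts 0 back there. So [M] is the quotient by the line of [b] and [N] a
    section. *)
Lemma rat_quotient n (b : 'rV[R]_n.+1) : rat b -> b != 0 ->
  exists (M : 'M[R]_(n.+1, n)) (N : 'M[R]_(n, n.+1)),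
  [/\ M \is a mxOver k, N \is a mxOver k, forall y : 'rV_n, y *m N *m M = y,
      b *m M = 0 & forall x : 'rV_n.+1, exists c, x = x *m M *m N + c *: b].
Proof.
move=> /mxOverP bk b0.
have [i bi] : exists i, b 0 i != 0.
  apply: contrapT => bi; case/eqP: b0; apply/rowP => i; rewrite mxE.
  by apply/eqP/negPn/negP => bi0; apply: bi; exists i.
pose M : 'M[R]_(n.+1, n) := \matrix_(l, j)
  ((l == lift i j)%:R - (l == i)%:R * (b 0 (lift i j) / b 0 i)).
pose N : 'M[R]_(n, n.+1) := \matrix_(j, l) (l == lift i j)%:R.
have sumd m (f : 'I_m -> R) c : \sum_l f l * (l == c)%:R = f c.
  rewrite (bigD1 c)//= eqxx mulr1 big1 ?addr0// => l /negbTE ->.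
  by rewrite mulr0.
have ME (x : 'rV_n.+1) j :
    (x *m M) 0 j = x 0 (lift i j) - x 0 i * (b 0 (lift i j) / b 0 i).
  rewrite mxE; under eq_bigr do rewrite mxE mulrBr [X in _ - X]mulrA.
  by rewrite sumrB sumd -mulr_suml sumd.
have NE (y : 'rV_n) j : (y *m N) 0 (lift i j) = y 0 j.
  rewrite mxE; under eq_bigr do rewrite mxE (inj_eq lift_inj) eq_sym.
  exact: sumd.
have Ni (y : 'rV_n) : (y *m N) 0 i = 0.
  by rewrite mxE big1// => j _; rewrite mxE (negbTE (neq_lift _ _)) mulr0.
exists M, N; split.
- apply/mxOverP => l j; rewrite mxE; apply: rpredB; first exact: rpred_nat.
  by apply: rpredM; [exact: rpred_nat|exact: rpred_div].
- by apply/mxOverP => j l; rewrite mxE rpred_nat.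
- by move=> y; apply/rowP => j; rewrite ME NE Ni mul0r subr0.
- by apply/rowP => j; rewrite ME mxE mulrCA divff// mulr1 subrr.
- move=> x; exists (x 0 i / b 0 i); apply/rowP => l; rewrite mxE [X in _ + X]mxE.
  case: (unliftP i l) => [j ->|->]; last by rewrite Ni add0r divfK.
  by rewrite NE ME; field.
Qed.

Lemma rat_mulmx n m (x : 'rV[R]_n) (M : 'M[R]_(n, m)) :
  rat x -> M \is a mxOver k -> rat (x *m M).
Proof. exact: mxOverM. Qed.

Lemma close_dot n (a x y : 'rV[R]_n) e : 0 <= e -> close e x y ->
  - (e * \sum_i `|a 0 i|) <= dot a (y - x).
Proof.
move=> e0 xy; rewrite lerNl -dotNr dotE mulr_sumr; apply: ler_sum => i _.
apply: le_trans (ler_norm _) _; rewrite normrM [e * _]mulrC.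
by apply: ler_wpM2l => //; rewrite !mxE opprB; exact: xy.
Qed.

(** * Projection along a ray of a cone, and lifting to fibres *)

Section Quotient.
Variables (n : nat) (b : 'rV[R]_n.+1) (M : 'M[R]_(n.+1, n)) (N : 'M[R]_(n, n.+1)).
Hypotheses (bk : rat b) (Mk : M \is a mxOver k) (Nk : N \is a mxOver k).
Hypotheses (NMK : forall y : 'rV_n, y *m N *m M = y) (bM : b *m M = 0).
Hypothesis MNb : forall x : 'rV_n.+1, exists c, x = x *m M *m N + c *: b.
Variables (D : set 'rV[R]_n.+1) (L : seq 'rV[R]_n.+1).
Hypotheses (Dk : rat_cone D) (Lk : all rat L) (DE : D = halfspaces L) (Db : D b).

Definition fiber (Y : set 'rV[R]_n) : set 'rV[R]_n.+1 := D `&` [set x | Y (x *m M)].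

Definition proj (X : set 'rV[R]_n.+1) : set 'rV[R]_n :=
  [set y | exists2 x, X x & y = x *m M].

Lemma quotient_eq x x' : x *m M = x' *m M -> exists c, x = x' + c *: b.
Proof.
move=> xx'; have [c xE] := MNb x; have [c' x'E] := MNb x'; exists (c - c').
have E : x - c *: b = x' - c' *: b by rewrite {1}xE {1}x'E xx' !addrK.
by rewrite -{1}(subrK (c *: b) x) E scalerBl addrA addrAC.
Qed.

Lemma fiber_halfspaces L' : fiber (halfspaces L') =
  halfspaces (L ++ [seq a *m M^T | a <- L']).
Proof.
rewrite /fiber DE; apply/seteqP; split=> [x [xL xL'] a|x xLL'].
  rewrite mem_cat => /orP[/xL //|/mapP[c cL' ->]].
  by rewrite -dot_mulmx xL'.
split=> [a aL|a aL']; first by apply: xLL'; rewrite mem_cat aL.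
rewrite dot_mulmx; apply: xLL'; rewrite mem_cat; apply/orP; right.
by apply/mapP; exists a.
Qed.

Lemma pullback_rat L' : all rat L' -> all rat (L ++ [seq a *m M^T | a <- L']).
Proof.
move=> L'k; rewrite all_cat Lk; apply/allP => _ /mapP[a aL' ->].
apply: rat_mulmx; first exact: (allP L'k).
by apply/mxOverP => i j; rewrite mxE (mxOverP Mk).
Qed.

Lemma fiber_rat_cone Y : rat_cone Y -> rat_cone (fiber Y).
Proof.
move=> /rat_cone_halfspaces[L' L'k ->]; rewrite fiber_halfspaces.
apply: halfspaces_rat_cone; first exact: pullback_rat.
by rewrite -fiber_halfspaces; apply: pointedW Dk.1 => x [].
Qed.

(** Extremality of [b] keeps the projection pointed: [e] vanishes at [b], so it descends to the
    quotient, and it is positive on [D] off the ray of [b]. *)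
Lemma proj_rat_cone X e : rat_cone X -> X `<=` D -> dot e b = 0 ->
  (forall x, D x -> 0 <= dot e x /\ (dot e x = 0 -> exists2 t, 0 <= t & x = t *: b)) ->
  rat_cone (proj X).
Proof.
move=> [_ [s sk XE]] XD eb eP; split.
  exists (e *m N^T) => _ [x /XD Dx ->] xM0; rewrite -dot_mulmx.
  have [c xE] := MNb x; have [ex0 exP] := eP x Dx.
  have <- : dot e x = dot e (x *m M *m N) by rewrite {1}xE !dotr eb mulr0 addr0.
  rewrite lt_neqAle ex0 andbT eq_sym; apply: contraNneq xM0 => /exP[t _ ->].
  by rewrite -scalemxAl bM scaler0.
exists [seq x *m M | x <- s]; last by rewrite cone_map XE.
by apply/allP => _ /mapP[x xs ->]; apply: rat_mulmx => //; exact: (allP sk).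
Qed.

Lemma fiberS Y Y' : Y `<=` Y' -> fiber Y `<=` fiber Y'.
Proof. by move=> YY' x [Dx /YY']. Qed.

Lemma fiber_proj_full : fiber (proj D) = D.
Proof. by apply/seteqP; split=> x; [case|split=> //; exists x]. Qed.

(** The points of [D] over [w] form a half-line in direction [b], and [b'] is its origin. On the
    line, an inequality [a] positive at [b] becomes an equality at parameter
    [- dot a (w *m N) / dot a b]; the largest of these values is attained by the tight
    inequality. *)
Lemma exit_point w : rat w -> b != 0 -> proj D w ->
  exists b' a, [/\ rat b', D b', b' *m M = w, a \in L & 0 < dot a b /\ dot a b' = 0].
Proof.
move=> wk b0 [x Dx wE].
have Dge a : a \in L -> 0 <= dot a b by move: Db; rewrite DE; apply.
(* Otherwise [- b] would satisfy all inequalities of [D], against pointedness. *)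
have Lp0 : [seq a <- L | 0 < dot a b] != [::].
  apply/eqP => Lp0; case/eqP: b0; apply: (pointed_opp Dk.1) => //.
  rewrite DE => a aL; rewrite dotr oppr_ge0 leNgt; apply/negP => ab.
  by have := mem_filter (fun a => 0 < dot a b) a L; rewrite Lp0 ab aL in_nil.
have [a] := seq_argmax (fun a => - dot a (w *m N) / dot a b) Lp0.
rewrite mem_filter => /andP[ab aL] amax.
have wNk : rat (w *m N) by exact: rat_mulmx.
exists (w *m N + (- dot a (w *m N) / dot a b) *: b), a; split=> //.
- rewrite ratD// ratZ// rpred_div ?rpredN ?dot_rat//; exact: (allP Lk).
- rewrite DE => c cL; rewrite !dotr.
  have := Dge c cL; rewrite le_eqVlt => /orP[/eqP cb|cb].
    rewrite -cb mulr0 addr0; have [t xE] := MNb x.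
    have : 0 <= dot c x by move: Dx; rewrite DE; apply.
    by rewrite xE !dotr -cb mulr0 addr0 wE.
  have := amax c; rewrite mem_filter cb cL => /(_ isT).
  by rewrite ler_pdivrMr// -subr_ge0 opprK addrC.
- by rewrite mulmxDl NMK -scalemxAl bM scaler0 addr0.
- by split=> //; rewrite !dotr divfK ?gt_eqF// subrr.
Qed.

(* Moving the projection of a point of D by d is compensated in D by a correction
   along b that is at most proportional to d. *)
Lemma fiber_lim (Y : nat -> set 'rV[R]_n) Q :
  (forall i, Y i `<=` proj D) ->
  (forall y e, Q y -> 0 < e -> exists i z, Y i z /\ close e y z) ->
  forall x e, fiber Q x -> 0 < e -> exists i z, fiber (Y i) z /\ close e x z.
Proof.
move=> YD Ylim x e [Dx Qx] e0.
(* Adding [(C * d) *: b] outweighs a displacement of size [d] in every inequality positive at [b].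
   Where [dot a b = 0] the quotient is 0 by convention, and the inequality depends only on the
   projection. [K] bounds the resulting change of a coordinate per unit of [d]. *)
have [C [C0 Cge _]] := seq_lub0 L (fun a => (\sum_i `|(a *m N^T) 0 i|) / dot a b).
have [K [K0 Kge _]] := seq_lub0 (enum 'I_n.+1)
  (fun j => \sum_i `|N i j| + C * `|b 0 j|).
have K10 : 0 < K + 1 by rewrite ltr_wpDl.
pose d := e / (K + 1); have d0 : 0 < d by exact: divr_gt0.
have [i [z [Yz xz]]] := Ylim _ d Qx d0; pose u := z - x *m M.
exists i, (x + u *m N + (C * d) *: b); split; first split.
- rewrite DE => a aL; rewrite !dotr.
  have : 0 <= dot a b by move: Db; rewrite DE; apply.
  rewrite le_eqVlt => /orP[/eqP ab|ab].
    rewrite -ab mulr0 addr0; have [x' Dx' zE] := YD i z Yz.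
    have [c xE] := MNb x; have [c' x'E] := MNb x'.
    have : 0 <= dot a x' by move: Dx'; rewrite DE; apply.
    have -> : dot a x' = dot a (z *m N) by rewrite x'E !dotr -ab mulr0 addr0 zE.
    have -> : dot a x = dot a (x *m M *m N).
      by rewrite {1}xE !dotr -ab mulr0 addr0.
    by rewrite mulmxBl !dotr addrC subrK.
  have : 0 <= dot a x by move: Dx; rewrite DE; apply.
  have := Cge a aL; rewrite ler_pdivrMr// => CL.
  have := close_dot (a *m N^T) (ltW d0) xz; rewrite -dot_mulmx -/u.
  have : d * (\sum_i `|(a *m N^T) 0 i|) <= d * (C * dot a b).
    by rewrite ler_pM2l.
  lra.
- rewrite /= mulmxDl mulmxDl NMK -scalemxAl bM scaler0 addr0 /u.
  by rewrite addrC subrK.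
move=> j; rewrite !mxE !opprD !addrA subrr add0r.
apply: le_trans (ler_normD _ _) _; rewrite !normrN normrM.
have := Kge j (mem_enum _ _) => Kj.
have -> : e = d * (K + 1) by rewrite /d divfK// gt_eqF.
have : `|\sum_i0 u 0 i0 * N i0 j| <= d * \sum_i `|N i j|.
  apply: le_trans (ler_norm_sum _ _ _) _; rewrite mulr_sumr; apply: ler_sum => l _.
  rewrite normrM; apply: ler_wpM2r => //.
  by rewrite /u [X in `|X|]mxE [X in _ + X]mxE distrC; exact: xz.
have : d * (\sum_i `|N i j| + C * `|b 0 j|) <= d * K by rewrite ler_pM2l.
rewrite (ger0_norm (mulr_ge0 C0 (ltW d0))); lra.
Qed.

End Quotient.

(** Quantifying over [r] here lets the induction hypothesis be applied to auxiliary relations. *)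
Definition inclusion_grows n :=
  forall r : set 'rV[R]_n -> set 'rV[R]_n -> Prop, growth r ->
  forall P Q, rat_cone P -> rat_cone Q -> P `<=` Q -> r P Q.

(* W contains the facets of D through which the rays from b may leave D \ X.  When
   b is replaced by an exit point b', a facet through b' is dropped from W. *)
Lemma conical_growth n : inclusion_grows n ->
  forall m r (X D : set 'rV[R]_n.+1) b e L (W : seq 'rV[R]_n.+1),
  growth r -> rat_cone X -> rat_cone D -> X `<=` D ->
  rat b -> X b -> b != 0 -> dot e b = 0 ->
  (forall x, D x -> 0 <= dot e x /\ (dot e x = 0 -> exists2 t, 0 <= t & x = t *: b)) ->
  (forall x c, D x -> 0 <= c -> X (x + c *: b) -> X x) ->
  all rat L -> D = halfspaces L -> (size W < m)%N ->
  (forall a x, a \in L -> dot a b != 0 -> D x -> ~ X x -> dot a x = 0 -> a \in W) ->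
  r X D.
Proof.
move=> IHn; elim=> // m IHm r X D b e L W gr Xk Dk XD bk Xb b0 eb eP con Lk DE Wm LW.
have [M [N [Mk Nk NMK bM MNb]]] := rat_quotient bk b0.
have Db := XD _ Xb; pose Fib := fiber M D.
have projk Y : rat_cone Y -> Y `<=` D -> rat_cone (proj M Y).
  by move=> Yk YD; exact: (proj_rat_cone Mk bM MNb Yk YD eb eP).
have Fibk Y : rat_cone Y -> rat_cone (Fib Y).
  exact: (fiber_rat_cone Mk Dk Lk DE).
have FibS Y Y' : Y `<=` Y' -> Fib Y `<=` Fib Y' by exact: fiberS.
pose r' Y Y' := Y `<=` Y' /\
  (proj M X `<=` Y -> Y' `<=` proj M D -> r (Fib Y) (Fib Y')).
(* By [con], and because [X] is closed under adding [b], the cone [X] consists of whole fibres of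
   [D]. *)
have FibX : Fib (proj M X) = X.
  apply/seteqP; split=> [x [Dx [x' Xx' xx']]|x Xx]; last first.
    by split; [exact: XD|exists x].
  have [c xE] := quotient_eq MNb xx'; have [c0|c0] := leP 0 c.
    rewrite xE; have [_ XD' XZ'] := rat_cone_convex Xk.
    by apply: XD' => //; exact: XZ'.
  apply: (con x (- c)) => //; first by rewrite oppr_ge0 ltW.
  by rewrite xE -addrA -scalerDl subrr scale0r addr0.
suff gr' : growth r'.
  have [|_] := IHn r' gr' _ _ (projk X Xk XD) (projk D Dk (@subset_refl _ D)).
    by move=> _ [x Xx ->]; exists x => //; exact: XD.
  rewrite /Fib fiber_proj_full -/(Fib _) FibX.
  apply; first exact: subset_refl.
  exact: subset_refl.
split.
- by move=> Y Yk; split=> // _ _; apply: (growth_refl gr); exact: Fibk.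
- move=> Y1 Y2 Y3 k1 k2 k3 [Y12 r12] [Y23 r23]; split; first exact: subset_trans Y23.
  move=> XY1 Y3D; apply: (growth_trans gr _ _ _ (r12 _ _) (r23 _ _)).
  + exact: Fibk.
  + exact: Fibk.
  + exact: Fibk.
  + by [].
  + exact: subset_trans Y3D.
  + exact: subset_trans Y12.
  + by [].
- move=> Y Y' Yk Y'k YY'; split; [exact: stacking_sub YY'|move=> XY Y'D].
  case: YY' => G [w [f [[Gk wk GY] [f0 fw YwG Y'E]]]].
  have Gc := rat_cone_convex Gk.
  pose T := adjoin G w.
  have TY' : T `<=` Y' by rewrite Y'E => x Tx; right.
  have Tw : T w by apply: adjoin_apex; case: Gc.
  have GT : G `<=` T by exact: mem_adjoin.
  have Tk : rat_cone T by apply: rat_cone_adjoin => //; exact: pointedW Y'k.1.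
  have YTG : links Y T G by exact: links_adjoin.
  have TD := subset_trans TY' Y'D.
  have [b' [a0 [b'k Db' b'w a0L [a0b a0b']]]] :=
    exit_point bk Nk NMK bM MNb Dk Lk DE Db wk b0 (TD _ Tw).
  have Fb' : Fib T b' by split; rewrite //= b'w.
  have lFib : links (Fib Y) (Fib T) (Fib G).
    move=> p z [Dp Yp] [Dz Tz]; have [t [t0 t1 Gg]] := YTG _ _ Yp Tz.
    exists t; split=> //; split; last by rewrite /= mulmxDl -!scalemxAl.
    by apply: convex_cone_segment => //; exact: (rat_cone_convex Dk).
  have FibY' : Fib Y' = Fib Y `|` Fib T.
    rewrite Y'E; apply/seteqP; split=> x; first by case=> Dx [|]; [left|right].
    by case=> -[Dx ?]; split=> //; [left|right].
  have FibU : Fib Y `|` Fib G = Fib Y by apply/setUidl/FibS.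
  (* The part over [Y] stays fixed and is glued along [Fib G]; it remains to grow [Fib G] to
     [Fib T]. *)
  pose r2 A B := A `<=` B /\
    (Fib G `<=` A -> B `<=` Fib T -> r (Fib Y `|` A) (Fib Y `|` B)).
  have gr2 : growth r2.
    apply: growth_glue => //; [exact: Fibk|exact: FibS|].
    by rewrite -FibY'; apply: pointedW Dk.1 => x [].
  suff [_] : r2 (Fib G) (Fib T) by rewrite FibU -FibY'; apply.
  pose K := adjoin (Fib G) b'.
  have KT : K `<=` Fib T.
    by apply: adjoin_min; [exact/rat_cone_convex/Fibk|exact: FibS|].
  have Kk : rat_cone K.
    apply: rat_cone_adjoin => //; first exact: Fibk.
    exact: pointedW (Fibk _ Tk).1.
  apply: (growth_trans gr2 (Fibk _ Gk) Kk (Fibk _ Tk)).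
    apply: (growth_stacking gr2) => //; first exact: Fibk.
    exists (Fib G), b', (f *m M^T); split; split=> //.
    + exact: Fibk.
    + by move=> x [_ /f0]; rewrite dot_mulmx.
    + by rewrite -dot_mulmx b'w.
    + move=> p z Gp _; exists 0; split=> //.
      by rewrite subr0 scale1r scale0r addr0.
    + by rewrite -/K; apply/esym/setUidr/mem_adjoin.
  have [LT LTk TE] := rat_cone_halfspaces Tk.
  have [g gP] := (projk D Dk (@subset_refl _ D)).1.
  (* Over [G] itself the fibre is contained in [K], so outside [K] the coefficient [t] of [w] is
     positive. The point [z + t *: b'] has the same projection as [x], hence differs from it by a
     multiple of [b]. *)
  have NK x : Fib T x -> ~ K x -> exists c t z m, [/\ G c, 0 < t, D z, c = z *m M &
      x *m M = c + t *: w /\ x = z + t *: b' + m *: b].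
    move=> [Dx [t t0 Gc']] Kx; have [z Dz zE] := TD _ (GT _ Gc').
    have [|m' xE] := quotient_eq MNb (x' := z + t *: b') (x := x).
      by rewrite mulmxDl -scalemxAl b'w -zE subrK.
    exists (x *m M - t *: w), t, z, m'; rewrite subrK; split=> //.
    rewrite lt_neqAle t0 andbT; apply/eqP => t00; apply: Kx; apply: mem_adjoin.
    by split=> //=; move: Gc'; rewrite -t00 scale0r subr0.
  have NX x : Fib T x -> ~ K x -> ~ X x.
    move=> [Dx Tx] Kx Xx; apply: Kx; apply: mem_adjoin; split=> //=.
    by apply: links_mem YTG _ Tx; apply: XY; exists x.
  have NKb' : ~ X b'.
    move=> Xb'; have : G w.
      by apply: links_mem YTG _ Tw; apply: XY; exists b'.
    by move/f0 => fw0; rewrite fw0 ltxx in fw.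
  (* The exit point lies in [D] outside [X] on the facet [a0], so [a0] was counted in [W]. *)
  have a0W : a0 \in W by apply: (LW a0 b') => //; rewrite gt_eqF.
  (* The functional exposing the ray of [b'] in [Fib T]: since [f] vanishes on [G], the corrected
     [g] vanishes on the ray of [w] and is positive on the rest of [T]; over the ray of [w], [a0]
     vanishes only at multiples of [b']. *)
  apply: (IHm r2 K (Fib T) b' ((g - (dot g w / dot f w) *: f) *m M^T + a0)
    (L ++ [seq a *m M^T | a <- LT]) (rem a0 W)) => //.
  + exact: Fibk.
  + by apply: adjoin_apex; case: (rat_cone_convex (Fibk _ Gk)).
  + by apply: contraTneq fw => b'0; rewrite -b'w b'0 mul0mx dot0r ltxx.
  + rewrite dotDl -dot_mulmx b'w a0b' addr0 dotBl dotZl divfK ?gt_eqF//.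
    exact: subrr.
  + move=> x [Dx [t t0 Gc']]; set g' := g - _.
    have g'x : dot g' (x *m M) = dot g (x *m M - t *: w).
      rewrite -{1}(subrK (t *: w) (x *m M)) /g' dotDr dotZr !dotBl !dotZl (f0 _ Gc').
      by rewrite divfK ?gt_eqF// mulr0 subrr mulr0 subr0 addr0.
    have gx0 : x *m M - t *: w != 0 -> 0 < dot g' (x *m M).
      by move=> cN0; rewrite g'x; apply: gP cN0; exact: TD (GT _ Gc').
    have a0x : 0 <= dot a0 x by move: Dx; rewrite DE; apply.
    rewrite dotDl -dot_mulmx; have [c0|/gx0 gx] := eqVneq (x *m M - t *: w) 0.
      rewrite g'x c0 dot0r add0r; split=> // a0x0; exists t => //.
      have [|m' xE] := quotient_eq MNb (x' := t *: b') (x := x).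
        by rewrite -scalemxAl b'w; apply/eqP; rewrite -subr_eq0 c0.
      move: a0x0; rewrite xE !dotr a0b' mulr0 add0r => /eqP.
      by rewrite mulf_eq0 (gt_eqF a0b) orbF => /eqP ->; rewrite scale0r addr0.
    split; first by rewrite addr_ge0// ltW.
    by move=> E; move: (ltr_wpDr a0x gx); rewrite E ltxx.
  + move=> x c [Dx [t t0 Gc']] c0 [u u0 [Du Gu]]; exists t => //.
    (* On [T] the functional [f] reads off the coefficient of [w]; it is compared on both sides. *)
    have tu : t = u - c.
      have : dot f ((x + c *: b' - u *: b') *m M - (x *m M - t *: w)) = 0.
        by rewrite dotBr (f0 _ Gc') (f0 _ Gu) subrr.
      rewrite mulmxBl mulmxDl -!scalemxAl b'w !dotr => E.
      have /eqP : (t - (u - c)) * dot f w = 0 by rewrite -[RHS]E; ring.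
      by rewrite mulf_eq0 (gt_eqF fw) orbF subr_eq0 => /eqP.
    suff -> : x - t *: b' = x + c *: b' - u *: b' by [].
    by rewrite tu scalerBl opprB addrA.
  + exact: pullback_rat.
  + by rewrite TE; exact: fiber_halfspaces.
  + by rewrite size_rem//; case: W Wm a0W {LW} => [|? ?].
  + move=> a x; rewrite mem_cat => aLT ab' Tx Kx ax0.
    have [c [t [z [m' [Gc' t0 Dz cE [xME xE]]]]]] := NK x Tx Kx.
    case/orP: aLT => [aL|/mapP[d dLT aE]].
      have Dge y : D y -> 0 <= dot a y by rewrite DE; apply.
      (* If [a] vanished at [b], then [dot a x] would be [dot a z + t * dot a b'] with both terms
         nonnegative, forcing [dot a b' = 0]. The inequalities pulled back from [T] are excluded in
         the same way, and [a] differs from [a0] because only [a0] vanishes at [b']. *)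
      have ab : dot a b != 0.
        apply/eqP => ab; case/eqP: ab'; apply/eqP; rewrite eq_le Dge// andbT.
        move: ax0; rewrite xE !dotr ab mulr0 addr0 => ax0.
        have := Dge z Dz; have := Dge b' Db'; nra.
      apply: rem_mem; first by apply: contraNneq ab' => ->; apply/eqP.
      by apply: LW ax0 => //; [case: Tx|exact: NX].
    have Tge y : T y -> 0 <= dot d y by rewrite TE; apply.
    case/eqP: ab'; move: ax0; rewrite aE -!dot_mulmx b'w xME !dotr => ax0.
    have := Tge _ Tw; have := Tge _ (GT _ Gc'); nra.
- move=> Y Q Yk Qk Yinc YQ Yr Ylim; split=> [|XY QD]; first exact: YQ.
  have XYi i : proj M X `<=` Y i.
    by elim: i => // i; move=> /subset_trans; apply; exact: Yinc.
  apply: (growth_lim gr (X := fun i => Fib (Y i))).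
  + by move=> i; exact: Fibk.
  + exact: Fibk.
  + by move=> i; exact: FibS.
  + by move=> i; exact: FibS.
  + by move=> i; apply: (Yr i).2 => //; exact: subset_trans QD.
  + apply: (fiber_lim NMK bM MNb DE Db _ Ylim).
    by move=> i; exact: subset_trans QD.
Qed.

(** The nonzero [p] excludes the case where [h] is negative on [Q] off the origin: the smaller cone
    would be zero and would offer no ray to project from. *)
Lemma halfspace_growth n : inclusion_grows n ->
  forall r (Q : set 'rV[R]_n.+1) h p, growth r -> rat_cone Q -> rat h ->
  Q p -> p != 0 -> 0 <= dot h p -> r (Q `&` halfspaces [:: h]) Q.
Proof.
move=> IHn r Q h p gr Qk hk Qp p0 hp.
have Qc := rat_cone_convex Qk; have [Q0 QD QZ] := Qc.
have mem1 (a x : 'rV[R]_n.+1) : halfspaces [:: a] x <-> 0 <= dot a x.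
  by split=> [|ax _ /[!inE]/eqP -> //]; apply; rewrite inE.
pose P1 := Q `&` halfspaces [:: h]; pose D := Q `&` halfspaces [:: - h].
pose F := P1 `&` halfspaces [:: - h].
have P1k : rat_cone P1 by apply: rat_coneI; rewrite //= hk.
have Dk : rat_cone D by apply: rat_coneI; rewrite //= ratN hk.
have Fk : rat_cone F by apply: rat_coneI; rewrite //= ratN hk.
have FE x : F x <-> Q x /\ dot h x = 0.
  split=> [[[Qx /mem1 hx] /mem1]|[Qx hx]].
    by rewrite dotNl oppr_ge0 => hx'; split=> //; apply/eqP; rewrite eq_le hx'.
  by split; [split=> //|]; apply/mem1; rewrite ?dotNl hx ?oppr0.
have FD : F `<=` D by move=> x [[Qx _] ?].
have FP : F `<=` P1 by move=> x [].
have P1D : P1 `|` D = Q.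
  apply/seteqP; split=> [x [[]//|[]//]|x Qx].
  have [hx|hx] := leP 0 (dot h x); first by left; split=> //; apply/mem1.
  by right; split=> //; apply/mem1; rewrite dotNl oppr_ge0 ltW.
have lPD : links P1 D F.
  move=> x z [Qx /mem1 hx] [Qz /mem1]; rewrite dotNl oppr_ge0 => hz.
  have [E|E] := eqVneq (dot h x - dot h z) 0.
    exists 0; split=> //; rewrite subr0 scale1r scale0r addr0.
    by apply/FE; split=> //; lra.
  have E0 : 0 < dot h x - dot h z by rewrite lt_neqAle eq_sym E; lra.
  have t0 : 0 <= dot h x / (dot h x - dot h z) by rewrite divr_ge0// ltW.
  have t1 : dot h x / (dot h x - dot h z) <= 1 by rewrite ler_pdivrMr//; lra.
  exists (dot h x / (dot h x - dot h z)); split=> //; apply/FE; split.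
    exact: convex_cone_segment.
  by rewrite !dotr; field.
have [F0|F0] := pselect (F = [set 0]).
  suff QE : Q `<=` P1.
    have -> : Q `&` halfspaces [:: h] = Q by apply/seteqP; split=> // x [].
    exact: (growth_refl gr).
  move=> z Qz; split=> //; apply/mem1; rewrite leNgt; apply/negP => hz.
  have [g gP] := Qk.1.
  have z0 : z != 0 by apply: contraTneq hz => ->; rewrite dot0r ltxx.
  (* A point with [h] negative would combine with [p] into a vector of [F], nonzero because [Q] is
     pointed. *)
  have : F (dot h p *: z + (- dot h z) *: p).
    apply/FE; split; last by rewrite !dotr; ring.
    by apply: QD; apply: QZ => //; rewrite oppr_ge0 ltW.
  rewrite F0 => /(congr1 (dot g)); rewrite !dotr.
  have := gP p Qp p0; have := gP z Qz z0; nra.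
have [b [e [bk Fb b0 eb eP]]] := extreme_ray Fk F0.
have hb : dot h b = 0 by case/FE: Fb.
have [_ [s sk sE]] := Dk.
(* [e] exposes [b] only within [F]. Since [- h] vanishes on [F] and is positive on the other
   generators of [D], a large multiple of it extends this to [D]; [C] makes [e'] at least 1 on those
   generators. *)
have [C [C0 Cge _]] := seq_lub0 s (fun v => (1 - dot e v) / (- dot h v)).
pose e' := C *: (- h) + e.
have e'b : dot e' b = 0 by rewrite dotDl dotZl dotNl hb eb; ring.
have e'P x : D x -> 0 <= dot e' x /\ (dot e' x = 0 -> exists2 t, 0 <= t & x = t *: b).
  rewrite sE; apply: (cone_min (C := [set x | 0 <= dot e' x /\ _])) => [|v vs /=].
    split=> /=.
    - by rewrite dot0r; split=> // _; exists 0; rewrite ?scale0r.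
    - move=> y z [y0 yP] [z0 zP]; rewrite dotDr; split; first exact: addr_ge0.
      move=> yz0; have [|t t0 ->] := yP; first lra.
      have [|u u0 ->] := zP; first lra.
      by exists (t + u); rewrite ?addr_ge0// scalerDl.
    - move=> c y c0 [y0 yP]; rewrite dotZr; split; first exact: mulr_ge0.
      move=> /eqP; rewrite mulf_eq0 => /orP[/eqP ->|/eqP/yP[t t0 ->]].
        by exists 0; rewrite ?scale0r.
      by exists (c * t); rewrite ?mulr_ge0// scalerA.
  have Dv : D v by rewrite sE; exact: cone_mem.
  case: (Dv) => Qv /mem1; rewrite dotNl le_eqVlt => /orP[/eqP hv|hv].
    have /eP : F v by apply/FE; split=> //; lra.
    by rewrite dotDl dotZl dotNl -hv mulr0 add0r.
  have := Cge v vs; rewrite ler_pdivrMr// => Cv.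
  suff e'v : 0 < dot e' v by split; [exact: ltW|move=> E; rewrite E ltxx in e'v].
  by rewrite dotDl dotZl dotNl; lra.
have PDp : pointed (P1 `|` D) by rewrite P1D; exact: Qk.1.
have gr2 := growth_glue gr P1k lPD FP PDp.
have [L Lk LE] := rat_cone_halfspaces Dk.
have con x c : D x -> 0 <= c -> F (x + c *: b) -> F x.
  move=> [Qx _] _ /FE[_ hx]; apply/FE; split=> //.
  by rewrite !dotr hb mulr0 addr0 in hx.
have [_] := conical_growth IHn gr2 Fk Dk FD bk Fb b0 e'b e'P con Lk LE
  (ltnSn (size L)) (fun a x aL _ _ _ _ => aL).
rewrite P1D; have -> : P1 `|` F = P1 by apply/setUidl.
by apply; [exact: subset_refl|exact: subset_refl].
Qed.

Lemma inclusion_growth n : inclusion_grows n.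
Proof.
elim: n => [|n IHn] r gr P Q Pk Qk PQ.
  suff -> : P = Q by exact: (growth_refl gr).
  apply/seteqP; split=> // x _; rewrite thinmx0.
  by case: (rat_cone_convex Pk).
have cut P' p : rat_cone P' -> P' `<=` Q -> P' p -> p != 0 -> r P' Q.
  move=> P'k P'Q Pp p0; have [L Lk LE] := rat_cone_halfspaces P'k.
  have P'E : P' = Q `&` halfspaces L by rewrite -LE setIidr.
  have : halfspaces L p by rewrite -LE.
  rewrite P'E; elim: L Lk {LE P'E} => [_ _|h L IH /= /andP[hk Lk] Lp].
    suff -> : Q `&` halfspaces [::] = Q by exact: (growth_refl gr).
    by apply/seteqP; split=> [x []|].
  have QLk : rat_cone (Q `&` halfspaces L) by exact: rat_coneI.
  have -> : Q `&` halfspaces (h :: L) = Q `&` halfspaces L `&` halfspaces [:: h].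
    apply/seteqP; split=> [x [Qx xL]|x [[Qx xL] xh]].
      split; first by split=> // a aL; apply: xL; rewrite in_cons aL orbT.
      by move=> a /[!inE] /eqP ->; apply: xL; rewrite mem_head.
    split=> // a; rewrite in_cons => /orP[/eqP ->|/xL //].
    by apply: xh; rewrite mem_head.
  have Lp' : halfspaces L p by move=> a aL; apply: Lp; rewrite in_cons aL orbT.
  apply: (growth_trans gr) (IH Lk Lp') => //; first by apply: rat_coneI; rewrite //= hk.
  apply: (halfspace_growth IHn (p := p)) => //; first by split=> //; exact: P'Q.
  by apply: Lp; rewrite mem_head.
have [P0|[p [Pp p0]]] : P = [set 0] \/ exists p, P p /\ p != 0; last exact: cut p0.
  have [PN0|PN0] := pselect (exists p, P p /\ p != 0); first by right.
  left; apply/seteqP; split=> [x Px|x ->]; last by case: (rat_cone_convex Pk).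
  by apply/eqP/negPn/negP => x0; apply: PN0; exists x.
have [Q0|Q0] := pselect (Q = [set 0]).
  by rewrite P0 Q0 -P0; exact: (growth_refl gr).
have [b [e [bk Qb b0 _ _]]] := extreme_ray Qk Q0.
have rayQ : adjoin P b `<=` Q by apply: adjoin_min => //; exact: (rat_cone_convex Qk).
have rayk : rat_cone (adjoin P b).
  by apply: rat_cone_adjoin => //; exact: pointedW Qk.1.
have P00 : P 0 by rewrite P0.
have rayb : adjoin P b b by exact: adjoin_apex.
apply: (growth_trans gr) (cut _ b rayk rayQ rayb b0) => //.
apply: (growth_stacking gr) => //; have [g gP] := Qk.1.
exists P, b, g; split; split=> //.
- by rewrite P0 => x ->; rewrite dot0r.
- exact: gP.
- move=> q z Pq _; exists 0; split=> //.
  by rewrite subr0 scale1r scale0r addr0.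
- by apply/esym/setUidr/mem_adjoin.
Qed.


End ConeInclusion.

(** * Convex and affine hulls *)

Section Hulls.
Variable R : realType.
Local Notation E := (finseq R).
Implicit Types (A B C : set E) (x y v : E) (e : R).

Lemma finseq_ext x y : (forall i, x i = y i) -> x = y.
Proof. by move=> xy; apply/val_inj/funext. Qed.

Lemma coordsN x i : (- x) i = - x i. Proof. by []. Qed.

Lemma convex_setE C : @convex_set R E C <->
  forall x y t, C x -> C y -> 0 <= t -> t <= 1 -> C (t *: x + (1 - t) *: y).
Proof.
split=> [CC x y t Cx Cy t0 t1|CC x y l].
  have := CC x y (Itv01 t0 t1); rewrite !inE => /(_ Cx Cy).
  by [].
by rewrite !inE => Cx Cy; apply: CC.
Qed.

Lemma conv_hull_convex A x y t : conv_hull A x -> conv_hull A y ->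
  0 <= t -> t <= 1 -> conv_hull A (t *: x + (1 - t) *: y).
Proof.
move=> Ax Ay t0 t1 C [CC AC]; apply: (convex_setE C).1 => //; first exact: Ax.
exact: Ay.
Qed.

Lemma conv_hull_set_convex A : @convex_set R E (conv_hull A).
Proof. by apply/convex_setE => x y t; exact: conv_hull_convex. Qed.

Lemma sub_conv_hull A : A `<=` conv_hull A.
Proof. exact: sub_gen_smallest. Qed.

Lemma conv_hull_min A C : @convex_set R E C -> A `<=` C -> conv_hull A `<=` C.
Proof. exact: smallest_sub. Qed.

(** The supporting functional attains [b] only at [v]. If [A] missed [v], it would be below [b] on
    [A], hence on the whole hull. *)
Lemma conv_hull_vertex A v : vertex (conv_hull A) v -> A v.
Proof.
move=> [f [b [fb vE]]].
have [Av fv] : (conv_hull A `&` [set x | f x = b]) v by rewrite -vE.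
apply: contrapT => NAv; suff : conv_hull A `<=` [set x | f x < b].
  by move=> /(_ _ Av) /=; rewrite fv ltxx.
apply: conv_hull_min.
  apply/convex_setE => x y t /= xb yb t0 t1.
  rewrite linearD !linearZ /=; have [->|tN0] := eqVneq t 0; first lra.
  have tp : 0 < t by rewrite lt_neqAle eq_sym tN0.
  have : 0 < t * (b - f x) by rewrite mulr_gt0// subr_gt0.
  have : 0 <= (1 - t) * (b - f y) by rewrite mulr_ge0 ?subr_ge0// ltW.
  by rewrite !mulrBr; lra.
move=> x Ax /=; rewrite lt_neqAle fb ?andbT; last exact: sub_conv_hull.
apply/eqP => fx; apply: NAv; suff -> : v = x by [].
have : (conv_hull A `&` [set x | f x = b]) x by split=> //; exact: sub_conv_hull.
by rewrite -vE.
Qed.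

Definition affine_closed C := forall x y t, C x -> C y -> C (t *: x + (1 - t) *: y).

Lemma sub_aff_hull A : A `<=` aff_hull A.
Proof.
move=> x Ax; exists 1%N, (fun=> 1), (fun=> x); split=> //.
  by rewrite big_ord1.
by rewrite big_ord1 scale1r.
Qed.

Lemma aff_hull_closed A : affine_closed (aff_hull A).
Proof.
move=> x y t [n [c [p [pA c1 ->]]]] [m [d [q [qA d1 ->]]]].
exists (n + m)%N, (fun i => match fintype.split i with
  inl j => t * c j | inr j => (1 - t) * d j end),
  (fun i => match fintype.split i with inl j => p j | inr j => q j end).
have sl j : fintype.split (lshift m j) = inl j :> 'I_n + 'I_m.
  by rewrite -[lshift m j]/(unsplit (inl j)) unsplitK.
have sr j : fintype.split (rshift n j) = inr j :> 'I_n + 'I_m.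
  by rewrite -[rshift n j]/(unsplit (inr j)) unsplitK.
split; first by move=> i; case: (fintype.split i).
- rewrite big_split_ord /=; under eq_bigr do rewrite sl.
  under [X in _ + X]eq_bigr do rewrite sr.
  by rewrite -!mulr_sumr c1 d1; ring.
- rewrite big_split_ord /=; under [in RHS]eq_bigr do rewrite sl.
  under [X in _ = _ + X]eq_bigr do rewrite sr.
  by rewrite !scaler_sumr; congr (_ + _); apply: eq_bigr => i _; rewrite scalerA.
Qed.

(* After translating a point p of C to the origin, C becomes a linear subspace. *)
Lemma aff_hull_min A C : affine_closed C -> A `<=` C -> aff_hull A `<=` C.
Proof.
move=> CC AC _ [n [c [q [qA c1 ->]]]].
case: n c q qA c1 => [|n] c q qA c1.
  by rewrite big_ord0 in c1; move: (oner_neq0 R); rewrite -c1 eqxx.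
pose p := q ord0; have Cp : C p by exact/AC/qA.
have CZ a z : C (p + z) -> C (p + a *: z).
  move=> Cz; have -> : p + a *: z = a *: (p + z) + (1 - a) *: p.
    by apply: finseq_ext => i; rewrite !coordsD !coordsZ !coordsD; ring.
  exact: CC.
have CD z z' : C (p + z) -> C (p + z') -> C (p + (z + z')).
  (* The midpoint of [p + z] and [p + z'], dilated by 2 about [p]. *)
  move=> Cz Cz'; have -> : p + (z + z') =
      2 *: (2^-1 *: (p + z) + (1 - 2^-1) *: (p + z')) + (1 - 2) *: p.
    by apply: finseq_ext => i; rewrite !(coordsD, coordsZ); field.
  by apply: (CC) => //; exact: CC.
have -> : \sum_i c i *: q i = p + \sum_i c i *: (q i - p).
  under [in RHS]eq_bigr do rewrite scalerBr.
  by rewrite sumrB -scaler_suml c1 scale1r addrC subrK.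
elim/big_ind: _ => [||i _]; first by rewrite addr0.
  exact: CD.
by apply: CZ; rewrite addrC subrK; exact/AC/qA.
Qed.

Lemma aff_hullS A B : A `<=` aff_hull B -> aff_hull A `<=` aff_hull B.
Proof. by move=> AB; apply: aff_hull_min => //; exact: aff_hull_closed. Qed.

Lemma aff_hull_conv_hull A : aff_hull (conv_hull A) = aff_hull A.
Proof.
apply/seteqP; split; apply: aff_hullS.
  apply: conv_hull_min; last exact: sub_aff_hull.
  by apply/convex_setE => x y t Ax Ay _ _; exact: aff_hull_closed.
by apply: subset_trans (@sub_aff_hull _); exact: sub_conv_hull.
Qed.

Lemma has_dim_succ_eq A B n : aff_hull A = aff_hull B ->
  has_dim_succ A n -> has_dim_succ B n.
Proof. by move=> AB [x [xi xA]]; exists x; rewrite -AB. Qed.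

(** In an affine dependence, a nonzero coefficient of [v] would express [v] through the other
    points. *)
Lemma has_dim_succU1 A v n : has_dim_succ A n -> ~ aff_hull A v ->
  has_dim_succ (A `|` [set v]) n.+1.
Proof.
move=> [x [xi xA]] Av.
pose x' (i : 'I_n.+1) := if unlift ord0 i is Some j then x j else v.
have x'0 : x' ord0 = v by rewrite /x' unlift_none.
have x'S j : x' (lift ord0 j) = x j by rewrite /x' liftK.
exists x'; split.
  move=> c; rewrite !big_ord_recl x'0 => c0.
  have -> : \sum_(i < n) c (lift ord0 i) *: x' (lift ord0 i) =
    \sum_(i < n) c (lift ord0 i) *: x i by apply: eq_bigr => j _; rewrite x'S.
  move=> cx0; have [c00|c0N] := eqVneq (c ord0) 0.
    have cS j : c (lift ord0 j) = 0.
      apply: (xi (fun j => c (lift ord0 j))).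
        by rewrite c00 add0r in c0.
      by rewrite c00 scale0r add0r in cx0.
    by move=> i; case: (unliftP ord0 i) => [j ->|->].
  case: Av; rewrite -xA; exists n, (fun j => - (c (lift ord0 j) / c ord0)), x; split.
  - by move=> i; exists i.
  - rewrite sumrN -mulr_suml; move/eqP : c0; rewrite addrC addr_eq0 => /eqP ->.
    by rewrite mulNr opprK divff.
  - apply: (scalerI c0N); rewrite scaler_sumr.
    move/eqP : cx0; rewrite addr_eq0 => /eqP ->; rewrite -sumrN.
    apply: eq_bigr => j _; rewrite scalerA mulrN mulrCA divff// mulr1.
    by rewrite scaleNr.
apply/seteqP; split; apply: aff_hullS.
  move=> _ [i _ <-]; case: (unliftP ord0 i) => [j ->|->].
    rewrite x'S; have : aff_hull A (x j) by rewrite -xA; apply: sub_aff_hull; exists j.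
    by apply: aff_hullS => y Ay; apply: sub_aff_hull; left.
  by rewrite x'0; apply: sub_aff_hull; right.
move=> y [Ay|->]; last by apply: sub_aff_hull; exists ord0.
have : aff_hull (range x) y by rewrite xA; exact: sub_aff_hull.
apply: aff_hullS => _ [j _ <-]; apply: sub_aff_hull.
by exists (lift ord0 j).
Qed.

Lemma has_dim_succ_seq (s : seq E) : exists n, has_dim_succ [set` s] n.
Proof.
elim: s => [|v s [n sn]].
  exists 0%N, (fun i : 'I_0 => 0); split; first by move=> c _ _ [].
  by congr aff_hull; apply/seteqP; split=> [x [[]]|x].
have sE : [set` v :: s] = [set` s] `|` [set v].
  apply/seteqP; split=> x /=; rewrite in_cons.
    by case/orP => [/eqP ->|xs]; [right|left].
  by case=> [xs|->]; rewrite ?eqxx// xs orbT.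
rewrite sE; have [Av|Av] := pselect (aff_hull [set` s] v).
  exists n; apply: has_dim_succ_eq sn; apply/seteqP; split; apply: aff_hullS.
    by move=> x sx; apply: sub_aff_hull; left.
  by move=> x [sx|->]; [exact: sub_aff_hull|].
by exists n.+1; exact: has_dim_succU1.
Qed.

Lemma polytope_has_dim_succ A : polytope A -> exists n, has_dim_succ A n.
Proof.
move=> [S /finite_seqP[s ->] ->]; have [n sn] := has_dim_succ_seq s.
by exists n; apply: has_dim_succ_eq sn; rewrite aff_hull_conv_hull.
Qed.

Lemma coord_le_norm x i : `|x i| <= `|x|.
Proof.
have [n xn] := finseq_bound x.
have -> : `|x| = Num.sqrt (\sum_(i < n) x i ^+ 2) by exact: euclid_normE.
rewrite -sqrtr_sqr; apply: ler_wsqrtr.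
have [ni|ni] := leqP n i.
  by rewrite xn// expr0n/= sumr_ge0// => j _; exact: sqr_ge0.
rewrite (bigD1 (Ordinal ni))//= lerDl sumr_ge0// => j _; exact: sqr_ge0.
Qed.

Lemma closure_norm A x : closure A x <->
  forall e, 0 < e -> exists2 y, A y & `|x - y| < e.
Proof.
split=> [Ax e e0|Ax B /nbhs_ballP[e /= e0 eB]].
  have [y [Ay]] := Ax _ (nbhsx_ballx x e e0).
  by rewrite -ball_normE /= => xy; exists y.
have [y Ay xy] := Ax e e0; exists y; split=> //; apply: eB.
by rewrite -ball_normE.
Qed.

Lemma edist_inf_lt A x e : 0 < e ->
  (edist_inf A x < e%:E)%E <-> exists2 y, A y & `|x - y| < e.
Proof.
move=> e0; split.
  move=> /ereal_inf_lt[_ [y Ay <-]] /edist_lt_ball /=; rewrite -ball_normE.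
  by exists y.
move=> [y Ay xy]; pose d := (`|x - y| + e) / 2.
have [xd de] : `|x - y| < d /\ d < e by rewrite /d; split; lra.
have d0 : 0 < d by exact: le_lt_trans xd.
apply: (@le_lt_trans _ _ d%:E); last by rewrite lte_fin.
apply: (@le_trans _ _ (edist (x, y))); first by apply: ereal_inf_lbound; exists y.
by apply: edist_fin; rewrite //= -ball_normE.
Qed.

End Hulls.

(** * Slices of cones *)

Section Slices.
Variables (R : realType) (n : nat).
Local Notation E := (finseq R).
Local Notation V := 'rV[R]_n.+1.
Implicit Types (X Y Z G : set V) (x y v w f : V) (s : seq V) (p q : E).

Definition supported p := forall i, (n <= i)%N -> p i = 0.

Definition homogenize p : V := \row_j (if unlift ord0 j is Some i then p i else 1).

Definition dehomogenize_coords x (i : nat) : R^o :=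
  if insub i is Some j then x 0 (lift ord0 (j : 'I_n)) else 0.

Lemma dehomogenize_subproof x : dehomogenize_coords x \in @fin_supp R.
Proof.
apply/fin_suppP; exists n => i ni.
by rewrite /dehomogenize_coords insubF// ltnNge ni.
Qed.

(** Coordinate 0 is dropped without dividing by it, which keeps the map linear; it is inverse to
    [homogenize] only at height 1. *)
Definition dehomogenize x : E := FinSeq (dehomogenize_subproof x).

Definition slice X : set E := [set p | supported p /\ X (homogenize p)].

(** For a finitely generated cone: its slice is bounded and generates it. *)
Definition positive X := forall x, X x -> x != 0 -> 0 < x 0 0.

Lemma homogenize0 p : homogenize p 0 0 = 1.
Proof. by rewrite mxE unlift_none. Qed.

Lemma homogenizeS p (i : 'I_n) : homogenize p 0 (lift ord0 i) = p i.
Proof. by rewrite mxE liftK. Qed.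

Lemma homogenize_neq0 p : homogenize p != 0.
Proof.
apply/eqP => p0; have := homogenize0 p; rewrite p0 mxE => /esym/eqP.
by rewrite oner_eq0.
Qed.

Lemma dehomogenizeE x (i : 'I_n) : dehomogenize x i = x 0 (lift ord0 i).
Proof.
rewrite /dehomogenize /= /dehomogenize_coords insubT// => h.
by congr (x 0 (lift ord0 _)); exact: val_inj.
Qed.

Lemma dehomogenize_supported x : supported (dehomogenize x).
Proof.
by move=> i ni; rewrite /dehomogenize /= /dehomogenize_coords insubF// ltnNge ni.
Qed.

Lemma homogenizeK p : supported p -> dehomogenize (homogenize p) = p.
Proof.
move=> sp; apply: finseq_ext => i; have [ni|ni] := leqP n i.
  by rewrite dehomogenize_supported// sp.
by rewrite (dehomogenizeE _ (Ordinal ni)) homogenizeS.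
Qed.

Lemma dehomogenizeK x : x 0 0 = 1 -> homogenize (dehomogenize x) = x.
Proof.
move=> x0; apply/rowP => j; case: (unliftP ord0 j) => [i ->|->].
  by rewrite homogenizeS dehomogenizeE.
by rewrite homogenize0 x0.
Qed.

Lemma dehomogenizeD x y : dehomogenize (x + y) = dehomogenize x + dehomogenize y.
Proof.
apply: finseq_ext => i; rewrite coordsD; have [ni|ni] := leqP n i.
  by rewrite !dehomogenize_supported// addr0.
by rewrite !(dehomogenizeE _ (Ordinal ni)) mxE.
Qed.

Lemma dehomogenizeZ c x : dehomogenize (c *: x) = c *: dehomogenize x.
Proof.
apply: finseq_ext => i; rewrite coordsZ; have [ni|ni] := leqP n i.
  by rewrite !dehomogenize_supported// mulr0.
by rewrite !(dehomogenizeE _ (Ordinal ni)) mxE.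
Qed.

Lemma homogenize_conv p q t :
  homogenize (t *: p + (1 - t) *: q) = t *: homogenize p + (1 - t) *: homogenize q.
Proof.
apply/rowP => j; rewrite [RHS]mxE [X in _ = X + _]mxE [X in _ = _ + X]mxE.
case: (unliftP ord0 j) => [i ->|->]; last by rewrite !homogenize0; ring.
by rewrite !homogenizeS coordsD !coordsZ.
Qed.

Lemma supported_conv p q t : supported p -> supported q ->
  supported (t *: p + (1 - t) *: q).
Proof.
by move=> sp sq i ni; rewrite coordsD !coordsZ sp// sq// !mulr0 addr0.
Qed.

(** The linear part of the affine function [dot f (homogenize p)], in the form that [face]
    requires. *)
Definition slope f p : R := \sum_i f 0 (lift ord0 i) * p (nat_of_ord i).

Lemma slope_scalar f : scalar (slope f).
Proof.
move=> a p q; rewrite /slope mulr_sumr -big_split /=; apply: eq_bigr => i _.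
transitivity (f 0 (lift ord0 i) * (a * p i + q i)); [by []|ring].
Qed.

Lemma slopeN f p : slope (- f) p = - slope f p.
Proof. by rewrite /slope -sumrN; apply: eq_bigr => i _; rewrite mxE mulNr. Qed.

HB.instance Definition _ f :=
  GRing.isLinear.Build R E R *%R (slope f) (slope_scalar f).

Lemma dot_homogenize f p : dot f (homogenize p) = f 0 0 + slope f p.
Proof.
rewrite dotE big_ord_recl homogenize0 mulr1; congr (_ + _).
by apply: eq_bigr => i _; rewrite homogenizeS.
Qed.

Lemma slice_convex X : convex_cone X -> @convex_set R E (slice X).
Proof.
move=> [_ XD XZ]; apply/convex_setE => p q t [sp Xp] [sq Xq] t0 t1; split.
  exact: supported_conv.
by rewrite homogenize_conv; apply: XD; apply: XZ; rewrite ?subr_ge0.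
Qed.

Lemma mem_slice X v : v 0 0 = 1 -> slice X (dehomogenize v) <-> X v.
Proof.
move=> v1; split=> [[_]|Xv]; first by rewrite dehomogenizeK.
by split; [exact: dehomogenize_supported|rewrite dehomogenizeK].
Qed.

Definition normalized s := {in s, forall v, v 0 0 = 1}.

Lemma slice_cone s : normalized s ->
  slice (cone s) = conv_hull [set` [seq dehomogenize v | v <- s]].
Proof.
move=> s1; set S := [set` _]; apply/seteqP; split; last first.
  apply: conv_hull_min; first exact: slice_convex (cone_convex s).
  by move=> _ /mapP[v vs ->]; apply/mem_slice; [exact: s1|exact: cone_mem].
(* The cone over the hull. A sum, rescaled to height 1, is the convex combination of the rescaled
   summands with weights proportional to their heights. *)
pose C : set V := [set x : V | x = 0 \/
  0 < x 0 0 /\ conv_hull S (dehomogenize ((x 0 0)^-1 *: x))].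
have sC : cone s `<=` C.
  apply: cone_min => [|v vs]; last first.
    right; rewrite s1// invr1 scale1r; split=> //; apply: sub_conv_hull.
    by apply/mapP; exists v.
  split; first by left.
  - move=> x y [->|[x0 Sx]]; first by rewrite add0r.
    move=> [->|[y0 Sy]]; first by rewrite addr0; right.
    right; rewrite mxE; split; first exact: addr_gt0.
    have xy0 : 0 < x 0 0 + y 0 0 by exact: addr_gt0.
    have -> : (x 0 0 + y 0 0)^-1 *: (x + y) =
        (x 0 0 / (x 0 0 + y 0 0)) *: ((x 0 0)^-1 *: x) +
        (1 - x 0 0 / (x 0 0 + y 0 0)) *: ((y 0 0)^-1 *: y).
      by apply/rowP => i; rewrite !mxE; field; rewrite !gt_eqF.
    rewrite dehomogenizeD (dehomogenizeZ (x 0 0 / _)) (dehomogenizeZ (1 - _)).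
    apply: conv_hull_convex => //.
      by rewrite divr_ge0// ltW.
    by rewrite ler_pdivrMr// mul1r lerDl ltW.
  - move=> c x c0 [->|[x0 Sx]]; first by left; rewrite scaler0.
    have [->|cN0] := eqVneq c 0; first by left; rewrite scale0r.
    have cp : 0 < c by rewrite lt_neqAle eq_sym cN0.
    right; rewrite mxE pmulr_rgt0//; split=> //.
    by rewrite scalerA invfM mulrAC mulVf// mul1r.
move=> p [sp /sC[/eqP|[_]]]; first by rewrite (negbTE (homogenize_neq0 p)).
by rewrite homogenize0 invr1 scale1r homogenizeK.
Qed.

(** Each inequality is Lipschitz in the point, with constant [K], so a violation persists nearby;
    [K + 1] avoids division by 0. *)
Lemma closed_slice L : closure (slice (halfspaces L)) `<=` slice (halfspaces L).
Proof.
move=> p /closure_norm pL; split=> [i ni|a aL].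
  apply/eqP/negPn/negP => pi; have [|q [sq _]] := pL `|p i|; first by rewrite normr_gt0.
  have := coord_le_norm (p - q) i.
  have -> : (p - q) i = p i by rewrite -[RHS]subr0 -(sq i ni).
  by move=> /le_lt_trans /[apply]; rewrite ltxx.
rewrite leNgt; apply/negP => pa; pose K := \sum_i `|a 0 (lift (@ord0 n) i)|.
have K0 : 0 <= K by exact: sumr_ge0.
have [|q [sq /(_ a aL)]] := pL (- dot a (homogenize p) / (K + 1)).
  by rewrite divr_gt0 ?oppr_gt0// ltr_wpDl.
move=> qa pq; have : `|slope a (p - q)| <= K * `|p - q|.
  apply: le_trans (ler_norm_sum _ _ _) _; rewrite mulr_suml; apply: ler_sum => i _.
  by rewrite normrM ler_wpM2l// coord_le_norm.
move: qa pq; rewrite ltr_pdivlMr ?ltr_wpDl// raddfB /= !dot_homogenize.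
rewrite ler_norml => qa pq /andP[+ _].
have : 0 <= `|p - q| by [].
nra.
Qed.

End Slices.

(** * Polytopes over [k] as slices of rational cones *)

Section RationalSlices.
Variables (R : realType) (k : divringClosed R) (n : nat).
Local Notation E := (finseq R).
Local Notation V := 'rV[R]_n.+1.
Local Notation rat := (@rat R k _).
Local Notation rat_cone := (@rat_cone R k _).
Implicit Types (X Y Z G Q : set V) (x y v w f : V) (s : seq V) (p q : E).

Lemma positive_cone s : normalized s -> positive (cone s).
Proof.
move=> s1; pose C : set V := [set x : V | x = 0 \/ 0 < x 0 0].
suff sC : cone s `<=` C by move=> x /sC[->|//]; rewrite eqxx.
apply: cone_min => [|v vs]; last by right; rewrite s1.
split; first by left.
- move=> x y [->|x0] [->|y0]; rewrite ?add0r ?addr0; [by left|by right|by right|].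
  by right; rewrite mxE addr_gt0.
- move=> c x c0 [->|x0]; first by left; rewrite scaler0.
  have [->|cN0] := eqVneq c 0; first by left; rewrite scale0r.
  by right; rewrite mxE mulr_gt0// lt_neqAle eq_sym cN0.
Qed.

Lemma positive_pointed X : positive X -> pointed X.
Proof. by move=> Xp; exists (delta_mx 0 0) => x Xx x0; rewrite dot_delta Xp. Qed.

Lemma positive_normalized X : rat_cone X -> positive X ->
  exists s, [/\ all rat s, normalized s & X = cone s].
Proof.
move=> [_ [s sk ->]] sp; exists [seq (v 0 0)^-1 *: v | v <- s & v != 0].
have vp v : v \in s -> v != 0 -> 0 < v 0 0 by move=> vs; apply: sp; exact: cone_mem.
split.
- apply/allP => _ /mapP[v + ->]; rewrite mem_filter => /andP[v0 vs].
  have vk := allP sk v vs; apply: ratZ => //.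
  by rewrite rpredV; move/mxOverP : vk.
- move=> _ /mapP[v + ->]; rewrite mem_filter => /andP[v0 vs].
  by rewrite mxE mulVf// gt_eqF// vp.
- apply/seteqP; split; (apply: cone_min; first exact: cone_convex).
    move=> v vs; have [->|v0] := eqVneq v 0.
      by case: (cone_convex [seq (v 0 0)^-1 *: v | v <- s & v != 0]).
    have v00 := vp v vs v0.
    rewrite -[v]scale1r -(divff (lt0r_neq0 v00)) -scalerA.
    have [_ _ Z] := cone_convex [seq (v 0 0)^-1 *: v | v <- s & v != 0].
    apply: Z; first exact: ltW.
    by apply: cone_mem; apply/mapP; exists v; rewrite // mem_filter v0.
  move=> _ /mapP[v + ->]; rewrite mem_filter => /andP[v0 vs].
  have [_ _ Z] := cone_convex s; apply: Z; last exact: cone_mem.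
  by rewrite invr_ge0 ltW// vp.
Qed.

Lemma slice_polytope s : normalized s -> polytope (slice (cone s)).
Proof.
move=> s1; exists [set` [seq dehomogenize v | v <- s]]; first exact: finite_seq.
exact: slice_cone.
Qed.

Lemma Pol_slice X : rat_cone X -> positive X -> Pol k (slice X).
Proof.
move=> Xk Xp; have [s [sk s1 ->]] := positive_normalized Xk Xp.
split; first exact: slice_polytope.
move=> p; rewrite slice_cone// => /conv_hull_vertex /mapP[v vs ->] i.
have [ni|ni] := leqP n i; first by rewrite dehomogenize_supported// rpred0.
rewrite (dehomogenizeE _ (Ordinal ni)).
by have /mxOverP := allP sk v vs.
Qed.

(** Only the vertices are known to be rational, not all points of [l]. In an irredundant subsystem
    every generator is exposed, hence gives a vertex, hence is rational. *)
Lemma Pol_slice_ex (l : seq E) : Pol k (conv_hull [set` l]) ->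
  {in l, forall p, supported n p} ->
  exists X, [/\ rat_cone X, positive X & conv_hull [set` l] = slice X].
Proof.
move=> [_ lk] ln; pose s := [seq homogenize n p | p <- l].
have s1 : normalized s by move=> _ /mapP[p _ ->]; exact: homogenize0.
have sE : conv_hull [set` l] = slice (cone s).
  rewrite slice_cone// /s -map_comp.
  have -> : [seq (@dehomogenize R n \o homogenize n) p | p <- l] = l.
    rewrite -[RHS]map_id; apply/eq_in_map => p pl /=.
    by rewrite homogenizeK//; exact: ln.
  by [].
have [s' [s's s'E irr]] := irredundant_system s.
exists (cone s'); rewrite s'E; split=> //; last exact: positive_cone.
split; first exact/positive_pointed/positive_cone.
exists s' => //; apply/allP => b bs'.
have b1 : b 0 0 = 1 by apply/s1/s's.
have [s1' [s2' s'12]] : exists s1' s2', s' = s1' ++ b :: s2'.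
  by case/splitPr: bs' => s1' s2'; exists s1', s2'.
have [b0 bN] := irr _ _ _ s'12.
have s'p : pointed (cone (s1' ++ b :: s2')).
  by rewrite -s'12 s'E; exact/positive_pointed/positive_cone.
have [e [eb _ eP]] := irredundant_extreme k s'p b0 bN.
have : vertex (conv_hull [set` l]) (dehomogenize b).
  exists (slope (- e)), (e 0 0); split=> [p|].
    rewrite sE => -[sp]; rewrite -s'E s'12 => /eP[+ _].
    by rewrite /= slopeN dot_homogenize => ?; lra.
  apply/seteqP; split=> [_ ->|p [+ pe]].
    split; first by rewrite sE; apply/mem_slice; [|rewrite -s'E; exact: cone_mem].
    rewrite /= slopeN; move: eb; rewrite -(dehomogenizeK b1) dot_homogenize.
    by rewrite dehomogenizeK// => ?; lra.
  rewrite sE => -[sp]; rewrite -s'E s'12 => /eP[_].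
  rewrite dot_homogenize; move: pe; rewrite /= slopeN => pe.
  case; first lra.
  move=> t _ pb; have t1 : t = 1.
    by have := homogenize0 n p; rewrite pb mxE b1 mulr1.
  by rewrite /= -(homogenizeK sp) pb t1 scale1r.
move=> /lk bk; apply/mxOverP => i j; rewrite ord1.
case: (unliftP ord0 j) => [m ->|->]; last by rewrite b1 rpred1.
by rewrite -dehomogenizeE.
Qed.

Lemma adjoin_scale G w c : 0 < c -> adjoin G (c *: w) = adjoin G w.
Proof.
move=> c0; apply/seteqP; split=> x [t t0 Gx].
  by exists (t * c); rewrite ?mulr_ge0 ?(ltW c0)// -scalerA.
by exists (t / c); rewrite ?divr_ge0 ?(ltW c0)// scalerA divfK// gt_eqF.
Qed.

(** The closure of the difference is the whole pyramid: by [links] it meets [X] only in the base,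
    and a base point is a limit of points moved toward the apex, where [f] is positive. *)
Lemma slice_stacking X Y : rat_cone X -> rat_cone Y -> positive Y ->
  stacking k X Y -> pyramidal_extension (slice X) (slice Y).
Proof.
move=> Xk Yk Yp XY; have XsubY := stacking_sub XY.
case: XY => G [w0 [f [[Gk w0k GX] [f0 fw0 XwG0 YE]]]].
have Gc := rat_cone_convex Gk; have [G0 GD GZ] := Gc.
have w0Y : Y w0 by rewrite YE; right; exact: adjoin_apex.
have w00 : 0 < w0 0 0.
  by apply: Yp => //; apply: contraTneq fw0 => ->; rewrite dot0r ltxx.
have [w [wE w1 fw]] : exists w, [/\ adjoin G w0 = adjoin G w, w 0 0 = 1 & 0 < dot f w].
  exists ((w0 0 0)^-1 *: w0); rewrite adjoin_scale ?invr_gt0//; split=> //.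
    by rewrite mxE mulVf// gt_eqF.
  by rewrite dotZr mulr_gt0// invr_gt0.
pose T := adjoin G w; have TE : adjoin G w0 = T by [].
have TY : T `<=` Y by move=> x Tx; rewrite YE; right; rewrite TE.
have XTG : links X T G by rewrite -TE; exact: links_adjoin.
have GT : G `<=` T by exact: mem_adjoin.
have [|s [_ s1 Gs]] := positive_normalized Gk.
  by move=> x Gx; apply: Yp; exact/XsubY/GX.
have ws1 : normalized (w :: s) by move=> v /[!inE] /orP[/eqP ->|/s1].
have Ts : T = cone (w :: s) by rewrite /T Gs.
pose v := dehomogenize w.
have Tv : slice T v by apply/mem_slice => //; exact: adjoin_apex.
have Thull : slice T = conv_hull (slice G `|` [set v]).
  apply/seteqP; split; last first.
    apply: conv_hull_min; first by rewrite Ts; exact/slice_convex/cone_convex.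
    by move=> p [[sp /GT Tp]|->].
  rewrite Ts slice_cone//; apply: conv_hull_min; first exact: conv_hull_set_convex.
  move=> _ /mapP[u + ->]; rewrite in_cons => /orP[/eqP ->|us].
    by apply: sub_conv_hull; right.
  apply: sub_conv_hull; left; apply/mem_slice; first exact: s1.
  by rewrite Gs; exact: cone_mem.
have f_ge0 x : T x -> 0 <= dot f x /\ (dot f x = 0 -> G x).
  move=> [t t0 Gx]; have -> : dot f x = t * dot f w.
    by rewrite -[in LHS](subrK (t *: w) x) dotDr (f0 _ Gx) add0r dotZr.
  split; first by rewrite mulr_ge0// ltW.
  move=> /eqP; rewrite mulf_eq0 (gt_eqF fw) orbF => /eqP t00.
  by move: Gx; rewrite t00 scale0r subr0.
have [L Lk TL] : exists2 L, all rat L & T = halfspaces L.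
  apply: rat_cone_halfspaces; rewrite -TE; apply: rat_cone_adjoin => //.
  by apply: pointedW Yk.1; rewrite TE.
have DE : closure (slice Y `\` slice X) = slice T.
  apply/seteqP; split.
    rewrite TL; apply: subset_trans (@closed_slice _ _ L); apply: closureS.
    rewrite -TL => p [[sp]]; rewrite YE TE => -[Xp NXp|Tp _]; last by [].
    by case: NXp.
  move=> p [sp Tp]; apply/closure_norm => e e0.
  have [Xp|Xp] := pselect (X (homogenize n p)); last first.
    exists p; rewrite ?subrr ?normr0//; split; first by split=> //; exact: TY.
    by case.
  have Gp : G (homogenize n p) := links_mem XTG Xp Tp.
  have d0 : 0 < `|p - v| + e + 1 by rewrite ltr_pwDr// addr_ge0// ltW.
  pose t := e / (`|p - v| + e + 1).
  have t0 : 0 < t by exact: divr_gt0.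
  have t1 : t <= 1 by rewrite ler_pdivrMr// mul1r; have := normr_ge0 (p - v); lra.
  have Tq : slice T (t *: v + (1 - t) *: p).
    by rewrite Thull; apply: conv_hull_convex; rewrite -?Thull// ltW.
  exists (t *: v + (1 - t) *: p); first split.
  - by case: Tq => sq Tq; split=> //; exact: TY.
  - move=> [_ Xq]; have := links_mem XTG Xq Tq.2.
    move/f0; rewrite homogenize_conv dehomogenizeK// !dotr (f0 _ Gp) mulr0 addr0.
    by move/eqP; rewrite mulf_eq0 (gt_eqF t0) (gt_eqF fw).
  - have -> : p - (t *: v + (1 - t) *: p) = t *: (p - v).
      by apply: finseq_ext => i; rewrite !(coordsD, coordsZ, coordsN); ring.
    rewrite normrZ gtr0_norm// /t mulrAC ltr_pdivrMr// ltr_pM2l//.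
    by rewrite -addrA ltrDl; lra.
have XTE : slice T `&` slice X = slice G.
  apply/seteqP; split=> p.
    by move=> [[sp Tp] [_ Xp]]; split=> //; exact: links_mem XTG _ _.
  by move=> [sp Gp]; split; split=> //; [exact: GT|exact: GX].
have NGv : ~ aff_hull (slice G) v.
  have GC : affine_closed [set p | dot f (homogenize n p) = 0].
    move=> p q t /= pf qf; rewrite homogenize_conv !dotr pf qf; ring.
  move=> /(aff_hull_min GC) fv.
  have : dot f (homogenize n v) = 0 by apply: fv => p [_ /f0].
  by rewrite dehomogenizeK// => fw'; rewrite fw' ltxx in fw.
have Gpoly : polytope (slice G) by rewrite Gs; exact: slice_polytope.
rewrite /pyramidal_extension DE; split.
- by move=> p [sp /XsubY].
- by exists (slice G), v; split.
- split.
    exists (slope (- f)), (f 0 0).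
    split=> [p [_ /f_ge0[+ _]]|]; first by rewrite /= slopeN dot_homogenize => ?; lra.
    rewrite XTE; apply/seteqP; split=> p.
      move=> [sp Gp]; split; first by split=> //; exact: GT.
      by have := f0 _ Gp; rewrite /= slopeN dot_homogenize => ?; lra.
    move=> [[sp /f_ge0[_ +]]]; rewrite /= slopeN dot_homogenize => fG ?.
    by split=> //; apply: fG; lra.
  have [m Gm] := polytope_has_dim_succ Gpoly; exists m; rewrite XTE; split=> //.
  apply: has_dim_succ_eq (has_dim_succU1 Gm NGv).
  by rewrite Thull aff_hull_conv_hull.
Qed.

End RationalSlices.

(** * Hausdorff limits of slices *)

Section Limits.
Variable R : realType.
Local Notation E := (finseq R).

Lemma hausdorff_dist_ge0 (P Q : set E) : (0 <= hausdorff_dist P Q)%E.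
Proof. by rewrite /hausdorff_dist le_max lexx. Qed.

Lemma hausdorff_dist_le (P Q : set E) e : 0 < e -> P `<=` Q ->
  (forall q, Q q -> exists2 p, P p & `|q - p| < e) ->
  (hausdorff_dist P Q <= e%:E)%E.
Proof.
move=> e0 PQ PQe; rewrite /hausdorff_dist !ge_max lee_fin (ltW e0) /=.
apply/andP; split; apply: ge_ereal_sup => _ [x Px <-].
  by rewrite edist_inf0 ?lee_fin ?(ltW e0)//; exact: PQ.
by apply/ltW/edist_inf_lt => //; exact: PQe.
Qed.

Lemma hausdorff_dist_lt (P Q : set E) e p : 0 < e ->
  (hausdorff_dist P Q < e%:E)%E -> P p -> exists2 q, Q q & `|p - q| < e.
Proof.
move=> e0 PQ Pp; apply/edist_inf_lt => //; apply: le_lt_trans PQ.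
rewrite /hausdorff_dist !le_max; apply/orP; right; apply/orP; left.
by apply: ereal_sup_ubound; exists p.
Qed.

Lemma cvg_hausdorff0 (P : nat -> set E) (Q : set E) :
  (forall e, 0 < e -> exists N, forall i, (N <= i)%N ->
    (hausdorff_dist (P i) Q <= e%:E)%E) ->
  hausdorff_dist (P i) Q @[i --> \oo] --> 0%E.
Proof.
move=> PQ; apply/fine_cvgP; split.
  have [N NP] := PQ 1 ltr01; exists N => // i /= /NP i1.
  rewrite ge0_fin_numE ?hausdorff_dist_ge0//.
  by apply: le_lt_trans i1 _; exact: ltry.
apply/cvgrPdist_le => e e0; have [N NP] := PQ e e0; exists N => // i /= /NP ie.
rewrite sub0r normrN ger0_norm ?fine_ge0 ?hausdorff_dist_ge0//.
rewrite -lee_fin fineK// ge0_fin_numE ?hausdorff_dist_ge0//.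
by apply: le_lt_trans ie _; exact: ltry.
Qed.

Lemma hausdorff0_cvg (P : nat -> set E) (Q : set E) e : 0 < e ->
  hausdorff_dist (P i) Q @[i --> \oo] --> 0%E ->
  exists i, (hausdorff_dist (P i) Q < e%:E)%E.
Proof.
move=> e0 /(_ [set x | (x < e%:E)%E]) [|N _ NP].
  apply: (open_nbhs_nbhs (T := \bar R)); split; first exact: open_ereal_lt_ereal.
  by rewrite /= lte_fin.
by exists N; apply: NP => /=.
Qed.

Section Slices.
Variable n : nat.
Local Notation V := 'rV[R]_n.+1.
Implicit Types (X : nat -> set V) (x v : V) (s : seq V).

Lemma dehomogenize_norm x :
  `|dehomogenize x| <= \sum_j `|x 0 j| * `|@dehomogenize R n (delta_mx 0 j)|.
Proof.
rewrite {1}(row_sum_delta x).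
have -> : dehomogenize (\sum_j x 0 j *: delta_mx 0 j) =
    \sum_j x 0 j *: @dehomogenize R n (delta_mx 0 j).
  elim/big_ind2: _ => [|y p z q <- <-|j _].
  - by rewrite -(scale0r 0) dehomogenizeZ scale0r.
  - exact: dehomogenizeD.
  - exact: dehomogenizeZ.
apply: le_trans (ler_norm_sum _ _ _) _; apply: ler_sum => j _.
by rewrite normrZ.
Qed.

Lemma dehomogenize_close v e : v 0 0 = 1 -> 0 < e -> exists2 d, 0 < d &
  forall (Y : set V) y, convex_cone Y -> Y y -> close d v y ->
  exists2 p, slice Y p & `|dehomogenize v - p| < e.
Proof.
move=> v1 e0; pose C := \sum_j (`|v 0 j| + 1) * `|@dehomogenize R n (delta_mx 0 j)|.
have C0 : 0 <= C by apply: sumr_ge0 => j _; rewrite mulr_ge0// addr_ge0.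
have Ce0 : 0 < C + e + 1 by rewrite ltr_wpDl// addr_ge0// ltW.
(* This makes [2 * d <= 1], so [y] has height at least 1/2 and rescaling it at most doubles the
   error; the total is then at most [2 * d * C < e]. *)
pose d := e / (2 * (C + e + 1)); have d0 : 0 < d by rewrite divr_gt0// mulr_gt0.
exists d => // Y y [_ _ YZ] Yy vy.
have dE : 2 * d * (C + e + 1) = e by rewrite /d; field; rewrite gt_eqF.
have y0 : 1 / 2 <= y 0 0.
  have := vy 0; rewrite v1 ler_norml => /andP[_ ?].
  suff : 2 * d <= 1 by lra.
  have : 2 * d * (e + 1) <= 2 * d * (C + e + 1).
    by apply: ler_wpM2l; [rewrite mulr_ge0// ltW|lra].
  rewrite dE.
  have : 0 < 2 * d by rewrite mulr_gt0.
  nra.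
have yp : 0 < y 0 0 by lra.
exists (dehomogenize ((y 0 0)^-1 *: y)).
  apply/mem_slice; first by rewrite mxE mulVf// gt_eqF.
  by apply: YZ => //; rewrite invr_ge0 ltW.
have -> : dehomogenize v - dehomogenize ((y 0 0)^-1 *: y) =
    dehomogenize (v - (y 0 0)^-1 *: y).
  by rewrite -scaleN1r -dehomogenizeZ scaleN1r -dehomogenizeD.
apply: le_lt_trans (dehomogenize_norm _) _.
apply: (@le_lt_trans _ _ (2 * d * C)); last first.
  rewrite -[ltRHS]dE; rewrite ltr_pM2l; [lra|exact: mulr_gt0].
rewrite mulr_sumr; apply: ler_sum => j _; rewrite mulrA; apply: ler_wpM2r => //.
have -> : (v - (y 0 0)^-1 *: y) 0 j =
    (v 0 j * (y 0 0 - v 0 0) + (v 0 j - y 0 j)) / y 0 0.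
  by rewrite v1 !mxE; field; rewrite gt_eqF.
rewrite normrM normfV (gtr0_norm yp) ler_pdivrMr//.
apply: le_trans (ler_normD _ _) _; rewrite normrM.
have := vy j; have := vy 0; rewrite distrC => H0 Hj.
have : `|v 0 j| * `|y 0 0 - v 0 0| <= `|v 0 j| * d by rewrite ler_wpM2l.
have : d * (`|v 0 j| + 1) <= 2 * d * (`|v 0 j| + 1) * y 0 0.
  have := normr_ge0 (v 0 j); set a := `|v 0 j| => a0.
  have : 0 <= d * (a + 1) by rewrite mulr_ge0 ?(ltW d0)// addr_ge0.
  nra.
lra.
Qed.

(** Approximating the finitely many generators suffices: one index serves them all because the
    sequence ascends, and the points at distance less than [e] from a convex set form a convex
    set. *)
Lemma slice_cvg X s : (forall i, convex_cone (X i)) ->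
  (forall i, X i `<=` X i.+1) -> (forall i, X i `<=` cone s) -> normalized s ->
  (forall x e, cone s x -> 0 < e -> exists i y, X i y /\ close e x y) ->
  hausdorff_dist (slice (X i)) (slice (cone s)) @[i --> \oo] --> 0%E.
Proof.
move=> Xc Xinc Xs s1 Xlim; apply: cvg_hausdorff0 => e e0.
have sliceS (Y Z : set V) : Y `<=` Z -> slice Y `<=` slice Z.
  by move=> YZ p [sp /YZ].
have Xmono i j : (i <= j)%N -> X i `<=` X j.
  move=> /subnK <-; elim: (j - i)%N => // m IH.
  by apply: subset_trans IH _; rewrite addSn; exact: Xinc.
have [N NP] : exists N, {in s, forall v, exists2 p, slice (X N) p &
    `|dehomogenize v - p| < e}.
  elim: s s1 Xlim {Xs} => [|v s IH] s1 Xlim; first by exists 0%N.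
  have [||N NP] := IH.
  - by move=> u us; apply: s1; rewrite in_cons us orbT.
  - by move=> x e' sx; apply: Xlim; exact: mem_adjoin.
  have [d d0 dP] := dehomogenize_close (s1 v (mem_head _ _)) e0.
  have [i [y [Xy vy]]] := Xlim v d (cone_mem (mem_head v s)) d0.
  have [p Xp vp] := dP _ _ (Xc i) Xy vy.
  exists (maxn i N) => u; rewrite in_cons => /orP[/eqP ->|/NP[q Xq uq]].
    by exists p => //; apply: sliceS Xp; apply: Xmono; exact: leq_maxl.
  by exists q => //; apply: sliceS Xq; apply: Xmono; exact: leq_maxr.
exists N => i Ni; apply: hausdorff_dist_le => //; first exact: sliceS.
rewrite slice_cone//; apply: (conv_hull_min (C := [set q | exists2 p, _ & _])).
  apply/convex_setE => q q' t [p Xp qp] [p' Xp' qp'] t0 t1.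
  exists (t *: p + (1 - t) *: p').
    by apply: (convex_setE _).1 => //; exact: slice_convex.
  have -> : t *: q + (1 - t) *: q' - (t *: p + (1 - t) *: p') =
      t *: (q - p) + (1 - t) *: (q' - p').
    by apply: finseq_ext => j; rewrite !(coordsD, coordsZ, coordsN); ring.
  apply: le_lt_trans (ler_normD _ _) _.
  rewrite !normrZ (ger0_norm t0) (@ger0_norm _ (1 - t)) ?subr_ge0//.
  have [->|tN0] := eqVneq t 0; first lra.
  have tp : 0 < t by rewrite lt_neqAle eq_sym tN0.
  have : t * `|q - p| < t * e by rewrite ltr_pM2l.
  have : (1 - t) * `|q' - p'| <= (1 - t) * e by rewrite ler_wpM2l ?subr_ge0// ltW.
  lra.
move=> _ /mapP[v vs ->]; have [p Xp vp] := NP v vs.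
by exists p => //; apply: sliceS Xp; exact: Xmono.
Qed.

End Slices.
End Limits.

(** * Return from cones to polytopes *)

Section PolytopeInclusion.
Variables (R : realType) (k : divringClosed R).

Lemma supported_list (l : seq (finseq R)) :
  exists n, {in l, forall p, supported n p}.
Proof.
elim: l => [|p l [n ln]]; first by exists 0%N.
have [m pm] := finseq_bound p; exists (maxn m n) => q.
rewrite in_cons => /orP[/eqP ->|/ln qn] i; rewrite geq_max => /andP[mi ni].
  exact: pm.
exact: qn.
Qed.

Lemma supported_leq n m (p : finseq R) : (n <= m)%N -> supported n p -> supported m p.
Proof. by move=> nm pn i mi; apply: pn; exact: leq_trans mi. Qed.

Lemma polytope_closed (P : set (finseq R)) : Pol k P -> closure P `<=` P.
Proof.
move=> Pk; have [[S /finite_seqP[l ->] PE] _] := Pk; rewrite PE in Pk *.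
have [n ln] := supported_list l.
have [X [Xk _ ->]] := Pol_slice_ex Pk ln.
by have [L _ ->] := rat_cone_halfspaces Xk; exact: closed_slice.
Qed.

Lemma inclusion_order :
  Relation_Definitions.order (Pol k) (fun P Q => val P `<=` val Q).
Proof.
split=> [P|P Q S PQ QS|P Q PQ QP]; first by [].
  exact: subset_trans QS.
by apply/val_inj/seteqP.
Qed.

Lemma pyramidal_growth_sub (P Q : Pol k) : pyramidal_growth P Q -> val P `<=` val Q.
Proof.
elim=> [P' Q' []//|P'|P' Q' S _ PQ _ QS]; first exact: subset_refl.
exact: subset_trans QS.
Qed.

Lemma inclusion_limit_closed :
  limit_closed (fun P Q : Pol k => val P `<=` val Q).
Proof.
move=> P Q Pinc Plim p Pp.
apply: (polytope_closed (set_valP Q)); apply/closure_norm => e e0.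
have [i ie] := hausdorff0_cvg e0 Plim.
apply: (hausdorff_dist_lt e0 ie).
by elim: i {ie} => // i; exact: Pinc.
Qed.

Lemma sub_of_slice_sub n (X Y : set 'rV[R]_n.+1) : rat_cone k X -> positive X ->
  convex_cone Y -> slice X `<=` slice Y -> X `<=` Y.
Proof.
move=> Xk Xp Yc XY; have [s [sk s1 XE]] := positive_normalized Xk Xp.
rewrite XE; apply: cone_min => // v vs; apply/(mem_slice _ (s1 v vs)).
by apply: XY; apply/mem_slice; [exact: s1|rewrite XE; exact: cone_mem].
Qed.

Lemma order_contains_inclusion (r : Pol k -> Pol k -> Prop) :
  Relation_Definitions.order (Pol k) r ->
  (forall P Q, pyramidal_growth P Q -> r P Q) -> limit_closed r ->
  forall P Q : Pol k, val P `<=` val Q -> r P Q.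
Proof.
move=> [rR rT _] rpyr rlim P Q PQ.
have [[S /finite_seqP[lP ->] PE] _] := set_valP P.
have [[S' /finite_seqP[lQ ->] QE] _] := set_valP Q.
have [n1 Pn1] := supported_list lP; have [n2 Qn2] := supported_list lQ.
pose n := maxn n1 n2.
have [X [Xk Xp PX]] : exists X : set 'rV[R]_n.+1,
    [/\ rat_cone k X, positive X & val P = slice X].
  rewrite PE; apply: Pol_slice_ex; first by rewrite -PE; exact: set_valP.
  by move=> p /Pn1; apply: supported_leq; exact: leq_maxl.
have [Y [Yk Yp QY]] : exists X : set 'rV[R]_n.+1,
    [/\ rat_cone k X, positive X & val Q = slice X].
  rewrite QE; apply: Pol_slice_ex; first by rewrite -QE; exact: set_valP.
  by move=> p /Qn2; apply: supported_leq; exact: leq_maxr.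
have toPol (Z : set 'rV[R]_n.+1) : rat_cone k Z -> Z `<=` Y ->
    exists A : Pol k, val A = slice Z.
  move=> Zk ZY; have Zp : positive Z by move=> x /ZY; exact: Yp.
  by exists (exist _ (slice Z) (mem_set (Pol_slice Zk Zp))).
(* The bound by [Y] keeps intermediate cones positive; a pointed rational cone may otherwise have an
   unbounded slice, which is no element of [Pol k]. *)
pose r' (Z Z' : set 'rV[R]_n.+1) := Z `<=` Z' /\ (Z' `<=` Y ->
  forall A B : Pol k, val A = slice Z -> val B = slice Z' -> r A B).
suff gr' : growth k r'.
  have XY : X `<=` Y.
    by apply: sub_of_slice_sub => //; [exact: rat_cone_convex Yk|rewrite -PX -QY].
  by have [_] := inclusion_growth gr' Xk Yk XY; apply.
split.
- move=> Z Zk; split=> // _ A B AZ BZ.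
  by have -> : A = B by apply: val_inj; rewrite AZ.
- move=> Z1 Z2 Z3 k1 k2 k3 [Z12 r12] [Z23 r23]; split; first exact: subset_trans Z23.
  move=> Z3Y A C AZ CZ; have Z2Y := subset_trans Z23 Z3Y.
  have [B BZ] := toPol _ k2 Z2Y.
  by apply: (rT A B C); [exact: r12|exact: r23].
- move=> Z Z' Zk Z'k ZZ'; split=> [|Z'Y A B AZ BZ]; first exact: stacking_sub ZZ'.
  apply: rpyr; apply: Relation_Operators.rt_step; rewrite AZ BZ.
  by apply: (slice_stacking Zk Z'k) ZZ' => x /Z'Y; exact: Yp.
- move=> Z Q' Zk Q'k Zinc ZQ' Zr Zlim; split=> [|Q'Y A B AZ BZ]; first exact: ZQ'.
  have ZY i : Z i `<=` Y by exact: subset_trans Q'Y.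
  have /choice[F FZ] i : exists A : Pol k, val A = slice (Z i) by exact: toPol.
  have -> : A = F 0%N by apply: val_inj; rewrite AZ FZ.
  apply: rlim => [i|]; first by apply: (Zr i).2.
  have [s [_ s1 Q's]] : exists s, [/\ all (@rat R k _) s, normalized s & Q' = cone s].
    by apply: positive_normalized => // x /Q'Y; exact: Yp.
  under eq_fun do rewrite FZ BZ.
  rewrite Q's; apply: slice_cvg => //.
  + by move=> i; exact: rat_cone_convex (Zk i).
  + by move=> i; rewrite -Q's.
  + by rewrite -Q's.
Qed.

End PolytopeInclusion.

Theorem theoremA (R : realType) (k : divringClosed R) (P Q : Pol k) :
  transfinite_growth P Q <-> val P `<=` val Q.
Proof.
split=> [PQ|PQ r rorder rpyr rlim]; last exact: order_contains_inclusion.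
apply: (PQ (fun P Q => val P `<=` val Q)).
- exact: inclusion_order.
- exact: pyramidal_growth_sub.
- exact: inclusion_limit_closed.
Qed.
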